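(* Let $n\geq 1$, let $\Omega\subset\mathbb{R}^n$ be an open set, and let $V:\mathbb{R}^n\to\mathbb{R}$ be bounded and continuous with $V(x)>0$ for all $x\in\Omega$ and $V(x)\geq 0$ for all $x\in\mathbb{R}^n$. Then there exists a constant $C>0$, independent of $t$ and of the initial data, such that the following holds. Let $u_0\in L^2(\mathbb{R}^n)$ satisfy $\operatorname{supp}u_0\subset\Omega$ and \[ J_{0,h}^2:=\int_{\Omega}\frac{|u_0(x)|^2}{V(x)}\,dx<+\infty, \] and let $u\in C([0,\infty);L^2(\mathbb{R}^n))\cap C^1((0,\infty);L^2(\mathbb{R}^n))\cap C((0,\infty);H^2(\mathbb{R}^n))$ be the unique solution of \[ u_t-\Delta u+V(x)u=0\quad (t>0,\ x\in\mathbb{R}^n),\qquad u(0,x)=u_0(x)\quad (x\in\mathbb{R}^n). \] Then \[ (1+t)\|u(t,\cdot)\|^2\leq C\left(\|u_0\|^2+J_{0,h}^2\right)\qquad\text{for all } t\geq 0. \]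
   Context: All functions are real-valued. $\|\cdot\|$ denotes the norm of $L^2(\mathbb{R}^n)$. The operator $H:=-\Delta+V$ is non-negative and self-adjoint in $L^2(\mathbb{R}^n)$ with domain $H^2(\mathbb{R}^n)$, and a unique solution in the stated class exists for every $u_0\in L^2(\mathbb{R}^n)$. *)

(* Defs.v *)
From HB Require Import structures.
From mathcomp Require Import all_boot all_order all_algebra.
From mathcomp Require Import all_classical all_reals all_analysis.

Set Implicit Arguments.
Unset Strict Implicit.
Unset Printing Implicit Defensive.

Import Order.TTheory GRing.Theory Num.Theory.
Import numFieldNormedType.Exports.

Local Open Scope classical_set_scope.
Local Open Scope ring_scope.

(* The product (hence Borel) sigma-algebra of R^n: the smallest one making the
   coordinates measurable, as the library does for n.-tuple. *)
Definition rV_display : measure_display.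
Proof. exact: default_measure_display. Qed.

Section rV_measurable.
Variables (R : realType) (n : nat).

Let coord (i : 'I_n) (x : 'rV[R]_n) : R := x ord0 i.

Let rV_set0 : g_sigma_preimage coord set0.
Proof. exact: sigma_algebra0. Qed.

Let rV_setC A : g_sigma_preimage coord A -> g_sigma_preimage coord (~` A).
Proof. exact: sigma_algebraC. Qed.

Let rV_bigcup (F : _^nat) : (forall i, g_sigma_preimage coord (F i)) ->
  g_sigma_preimage coord (\bigcup_i (F i)).
Proof. exact: sigma_algebra_bigcup. Qed.

HB.instance Definition _ := @isMeasurable.Build rV_display
  'rV[R]_n (g_sigma_preimage coord) rV_set0 rV_setC rV_bigcup.

Lemma measurable_coord (i : 'I_n) :
  measurable_fun [set: 'rV[R]_n] (fun x : 'rV[R]_n => x ord0 i).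
Proof.
move=> _ Y mY; rewrite setTI; apply: sub_sigma_algebra => /=.
rewrite -bigcup_seq/=; exists i => /=; first by rewrite mem_index_enum.
by exists Y => //; rewrite setTI.
Qed.

Lemma measurable_fun_rV d (T : measurableType d) (f : T -> 'rV[R]_n) :
  (forall i, measurable_fun [set: T] (fun t => f t ord0 i)) ->
  measurable_fun [set: T] f.
Proof.
move=> mf _ A mA; rewrite setTI.
suff: g_sigma_preimage coord `<=` [set B | measurable (f @^-1` B)] by exact.
apply: smallest_sub.
  split=> [|B /= mB|F /= mF].
  - by rewrite /= preimage_set0.
  - by rewrite setTD preimage_setC; exact: measurableC.
  - by rewrite preimage_bigcup; exact: bigcup_measurable.
rewrite -bigcup_seq; apply: bigcup_sub => i _ _ [B mB <-] /=.
by rewrite setTI -comp_preimage -[X in measurable X]setTI; exact: mf.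
Qed.

End rV_measurable.

Section lebesgue_rV.
Variable R : realType.

Definition rV_cons n (p : R * 'rV[R]_n) : 'rV[R]_n.+1 :=
  \row_j oapp (fun i => p.2 ord0 i) p.1 (unlift ord0 j).

Definition rV_uncons n (x : 'rV[R]_n.+1) : R * 'rV[R]_n :=
  (x ord0 ord0, \row_j x ord0 (lift ord0 j)).

Lemma rV_consK n : cancel (@rV_cons n) (@rV_uncons n).
Proof.
case=> a x; congr pair; first by rewrite mxE unlift_none.
by apply/rowP => j; rewrite !mxE liftK.
Qed.

Lemma measurable_rV_cons n :
  measurable_fun [set: (R * 'rV[R]_n)%type] (@rV_cons n).
Proof.
apply: measurable_fun_rV => i.
under eq_fun do rewrite mxE.
case: (unlift ord0 i) => [j|] /=; last exact: measurable_fst.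
exact: (measurableT_comp (measurable_coord j) measurable_snd).
Qed.

Lemma measurable_rV_uncons n : measurable_fun [set: 'rV[R]_n.+1] (@rV_uncons n).
Proof.
apply/measurable_fun_pairP; split; first exact: measurable_coord.
apply: measurable_fun_rV => i /=.
under eq_fun do rewrite mxE.
exact: measurable_coord.
Qed.

Section step.
Variables (n : nat) (m : {sigma_finite_measure set 'rV[R]_n -> \bar R}).

Definition lebesgue_step : set 'rV[R]_n.+1 -> \bar R :=
  pushforward (@lebesgue_measure R \x m)%E (@rV_cons n).

Let lebesgue_step0 : lebesgue_step set0 = 0%E.
Proof. by rewrite /lebesgue_step /pushforward preimage_set0 measure0. Qed.

Let lebesgue_step_ge0 A : (0 <= lebesgue_step A)%E.
Proof. by rewrite /lebesgue_step /pushforward; exact: measure_ge0. Qed.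

Let lebesgue_step_sigma_additive : semi_sigma_additive lebesgue_step.
Proof.
move=> F mF tF mUF; rewrite /lebesgue_step /pushforward preimage_bigcup.
have mpre A : measurable A -> measurable (@rV_cons n @^-1` A).
  by move=> mA; rewrite -[X in measurable X]setTI; exact: measurable_rV_cons.
apply: measure_semi_sigma_additive => [k||].
- exact: mpre.
- apply/trivIsetP => /= i j _ _ ij; rewrite -preimage_setI.
  by move/trivIsetP : tF => /(_ _ _ _ _ ij) ->//; rewrite preimage_set0.
- by rewrite -preimage_bigcup; exact: mpre.
Qed.

HB.instance Definition _ := isMeasure.Build _ _ _
  lebesgue_step lebesgue_step0 lebesgue_step_ge0 lebesgue_step_sigma_additive.

Let lebesgue_step_sigma_finite : sigma_finite setT lebesgue_step.
Proof.
have /sigma_finiteP[F [FT ndF Foo]] := sigma_finiteT (@lebesgue_measure R).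
have /sigma_finiteP[G [GT ndG Goo]] := sigma_finiteT m.
exists (fun k => @rV_uncons n @^-1` (F k `*` G k)).
  rewrite -preimage_bigcup (_ : \bigcup_k _ = setT) ?preimage_setT//.
  rewrite -setXTT FT GT predeqE => -[x y]; split=> [[k _ []/= ? ?]|].
    by split; exists k.
  move=> [/= [k _ Fkx] [l _ Gly]]; exists (maxn k l) => //; split.
  - by move: x Fkx; exact/subsetPset/ndF/leq_maxl.
  - by move: y Gly; exact/subsetPset/ndG/leq_maxr.
move=> k; have [mF Fk] := Foo k; have [mG Gk] := Goo k; split.
  rewrite -[X in measurable X]setTI; apply: measurable_rV_uncons => //.
  exact: measurableX.
rewrite /lebesgue_step /pushforward -comp_preimage.
rewrite (_ : _ \o _ = id); last by apply/funext => x; exact: rV_consK.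
by rewrite preimage_id product_measure1E// lte_mul_pinfty// ge0_fin_numE.
Qed.

HB.instance Definition _ :=
  @Measure_isSigmaFinite.Build _ _ _ lebesgue_step lebesgue_step_sigma_finite.

End step.

(* Lebesgue measure on R^n, through R^0 = {0} and R^n.+1 = R * R^n. *)
Fixpoint lebesgue_rV n : {sigma_finite_measure set 'rV[R]_n -> \bar R} :=
  if n is k.+1 then lebesgue_step (lebesgue_rV k) else dirac (0 : 'rV[R]_0).

Lemma lebesgue_rV_box n (a b : 'rV[R]_n) :
  (forall i, a ord0 i <= b ord0 i) ->
  lebesgue_rV n [set x | forall i, a ord0 i <= x ord0 i <= b ord0 i] =
  (\prod_i (b ord0 i - a ord0 i))%:E.
Proof.
elim: n a b => [|n IHn] a b ab.
  rewrite big_ord0 /= diracE mem_set//= => -[]//.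
pose B := [set x : 'rV[R]_n | forall i,
  a ord0 (lift ord0 i) <= x ord0 i <= b ord0 (lift ord0 i)].
have mB : measurable B.
  rewrite (_ : B = \bigcap_(i in [set: 'I_n]) ((fun x : 'rV[R]_n => x ord0 i) @^-1`
      `[a ord0 (lift ord0 i), b ord0 (lift ord0 i)]%classic)); last first.
    apply/seteqP; split=> x /= Bx i; last by have := Bx i I; rewrite /= in_itv.
    by rewrite /= in_itv /=.
  apply: fin_bigcap_measurable => // i _.
  by rewrite -[X in measurable X]setTI; exact: measurable_coord.
rewrite /= /lebesgue_step /pushforward.
rewrite (_ : _ @^-1` _ = `[a ord0 ord0, b ord0 ord0]%classic `*` B); last first.
  apply/seteqP; split=> [[x y] /= xy|[x y] /= [+ By] i].
    split; first by have := xy ord0; rewrite in_itv /= mxE unlift_none.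
    by move=> i; have := xy (lift ord0 i); rewrite mxE liftK.
  rewrite in_itv /= => xab; rewrite mxE.
  by case: unliftP => [j ->|->] //=; exact: By.
rewrite product_measure1E//= lebesgue_measure_itv /= lte_fin.
pose a' := \row_i a ord0 (lift ord0 i); pose b' := \row_i b ord0 (lift ord0 i).
have -> : B = [set x | forall i, a' ord0 i <= x ord0 i <= b' ord0 i].
  by apply/seteqP; split=> x Bx i; have := Bx i; rewrite /= !mxE.
rewrite IHn; last by move=> i; rewrite !mxE.
under eq_bigr do rewrite !mxE.
rewrite big_ord_recl EFinM; congr (_ * _)%E.
case: ltgtP (ab ord0) => // -> _; by rewrite subrr.
Qed.

End lebesgue_rV.

Section sobolev.
Variables (R : realType) (n : nat).
Notation rV := 'rV[R]_n.
Notation mu := (lebesgue_rV R n).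
Implicit Types (f g phi : rV -> R) (u : R -> rV -> R) (I : set R) (t : R).

Definition L2 : set (rV -> R) := [set f | f \in Lfun mu 2%:E].

Definition L2norm f : R := fine ('N[mu]_2%:E[EFin \o f])%E.

(* Support of an L^2 class: the complement of the largest open set on which f
   vanishes almost everywhere. *)
Definition ess_support f : set rV :=
  [set x | forall U : set rV, open U -> U x ->
    ~ {ae mu, forall y, U y -> f y = 0}].

Definition partial (i : 'I_n) f : rV -> R := fun x => 'D_(delta_mx ord0 i) f x.

Definition iter_partial (s : seq 'I_n) f : rV -> R := foldr partial f s.

Definition smooth f := forall s : seq 'I_n,
  continuous (iter_partial s f) /\
  forall (i : 'I_n) (x : rV), derivable (iter_partial s f) x (delta_mx ord0 i).

Definition test_function phi :=
  smooth phi /\ compact (closure [set x | phi x != 0]).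

Definition is_weak_partial (i : 'I_n) f g := forall phi, test_function phi ->
  (\int[mu]_x (f x * partial i phi x) = - \int[mu]_x (g x * phi x))%R.

Definition has_weak_partial (i : 'I_n) f :=
  exists2 g, L2 g & is_weak_partial i f g.

(* A representative of the weak derivative in L^2, unique up to a null set;
   the junk value 0 is used when there is none. *)
Definition weak_partial (i : 'I_n) f : rV -> R :=
  xget (cst 0) [set g | L2 g /\ is_weak_partial i f g].

Definition H1 : set (rV -> R) :=
  [set f | L2 f /\ forall i, has_weak_partial i f].

Definition H2 : set (rV -> R) :=
  [set f | H1 f /\ forall i, H1 (weak_partial i f)].

Definition H2norm f : R := Num.sqrt (L2norm f ^+ 2 +
  \sum_(i < n) L2norm (weak_partial i f) ^+ 2 +
  \sum_(i < n) \sum_(j < n) L2norm (weak_partial j (weak_partial i f)) ^+ 2).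

Definition weak_laplacian f : rV -> R :=
  fun x => \sum_(i < n) weak_partial i (weak_partial i f) x.

Definition continuous_L2 I u := (forall t, I t -> L2 (u t)) /\
  forall t, I t -> L2norm (u s \- u t) @[s --> within I (nbhs t)] --> (0 : R).

Definition continuous_H2 I u := (forall t, I t -> H2 (u t)) /\
  forall t, I t -> H2norm (u s \- u t) @[s --> within I (nbhs t)] --> (0 : R).

Definition is_L2_derivative u t (v : rV -> R) :=
  L2norm (fun x => h^-1 * (u (t + h) x - u t x) - v x) @[h --> 0^'] --> (0 : R).

(* u_t - Delta u + V u = 0 on (0, oo), u(0) = u0, for u in
   C([0,oo); L^2), C^1((0,oo); L^2) and C((0,oo); H^2); only the values of u at
   nonnegative times matter. *)
Definition heat_solution (V u0 : rV -> R) u :=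
  [/\ continuous_L2 [set t | 0 <= t] u,
      continuous_H2 [set t | 0 < t] u,
      {ae mu, forall x, u 0 x = u0 x} &
      exists ut : R -> rV -> R,
        [/\ continuous_L2 [set t | 0 < t] ut,
            forall t, 0 < t -> is_L2_derivative u t (ut t) &
            forall t, 0 < t ->
              {ae mu, forall x, ut t x - weak_laplacian (u t) x + V x * u t x = 0}]].

(* J_{0,h}^2 *)
Definition weighted_sq_norm (Omega : set rV) (V u0 : rV -> R) : \bar R :=
  (\int[mu]_(x in Omega) (`|u0 x| ^+ 2 / V x)%:E)%E.

End sobolev.

(* Main.v *)
From HB Require Import structures.
Require Import Defs.
From mathcomp Require Import all_boot all_order all_algebra.
From mathcomp Require Import all_classical all_reals all_analysis.
From mathcomp Require Import measurable_realfun ring lra.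

(* Write A = -Delta + V, which is symmetric on H^2 and dominates V, and
   f(t) = ||u(t)||^2.  Then (u(s), u(t - s)) does not depend on s, so
   (u0, u(t)) = f(t/2) >= f(t).  On the other hand u0 is supported in Omega, so
   |(u0, u(t))| <= J (V u(t), u(t))^(1/2) <= J (A u(t), u(t))^(1/2), and
   (A u(t), u(t)) = - f'(t)/2.  Hence 2 f^2 <= - J^2 f', which integrates to
   2 t f(t) <= J^2, and C = 1 works.

   The symmetry of A is integration by parts in H^1.  For a weakly
   differentiable F in L^2 and a test function phi, the function
   h |-> (F, phi(. - h e)) has derivative (d_e F, phi(. - h e)), whence
   ||F(. + h e) - F|| <= |h| ||d_e F|| by density of test functions; so the
   difference quotients of F converge weakly to d_e F, and they are
   skew-adjoint by translation invariance. *)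

Set Implicit Arguments.
Unset Strict Implicit.
Unset Printing Implicit Defensive.

Import Order.TTheory GRing.Theory Num.Theory.
Import numFieldNormedType.Exports.

Local Open Scope classical_set_scope.
Local Open Scope ring_scope.

(** * Borel sets and translations of R^n *)

Section rV_borel.
Context {R : realType} {n : nat}.
Implicit Types (A : set 'rV[R]_n) (x q : 'rV[R]_n) (r : R).

(** The weight sees only u0, while the decay concerns u(t). Pairing u0 with u(t) lets Cauchy-Schwarz
    bring the two together, at a cost that is exactly the share of the dissipation due to V. The
    pairing identity stands in for the semigroup law. As u(0) is merely in L^2, all differentiation
    takes place on (0, oo), and time 0 is reached through the L^2 continuity of u.

    Weak derivatives are tested against smooth compactly supported functions only, whereas the
    symmetry of A pairs two H^1 functions. Moving translations, instead of mollifiers, between the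
    factors makes density of test functions in L^2 sufficient; no approximation in H^1 occurs. That
    density starts from functions built on exp(-1/x) that are nonzero exactly on open cubes, and a
    monotone class argument carries it to all Borel sets. *)

Definition cube q r : set 'rV[R]_n :=
  [set x | forall i, `|x ord0 i - q ord0 i| < r].

Lemma measurable_cube q r : measurable (cube q r).
Proof.
rewrite (_ : cube q r = \bigcap_(i in [set: 'I_n])
    ((fun x : 'rV[R]_n => x ord0 i) @^-1` ball (q ord0 i) r)); last first.
  by apply/seteqP; split=> x /= qx i; have := qx i; rewrite /ball /= distrC//; exact.
apply: fin_bigcap_measurable => // i _.
rewrite -[X in measurable X]setTI; apply: measurable_coord => //.
exact: measurable_ball.
Qed.

(** The index type is countable, so unions over it stay measurable, and these cubes are a base of
    the topology. *)
Definition rat_cube (p : 'rV[rat]_n * nat) : set 'rV[R]_n :=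
  cube (map_mx ratr p.1) p.2.+1%:R^-1.

Lemma open_rat_cube A x : open A -> A x ->
  exists2 p, rat_cube p x & rat_cube p `<=` A.
Proof.
move=> oA Ax; have /nbhs_ballP[e /= e0 eA] := open_nbhs_nbhs (conj oA Ax).
have [k ke] : exists k : nat, k.+1%:R^-1 < e / 2.
  have [k _ kP] := near_infty_natSinv_lt (PosNum (divr_gt0 e0 (ltr0Sn R 1))).
  by exists k; exact: (kP k (leqnn _)).
have r0 : (0 : R) < k.+1%:R^-1 by rewrite invr_gt0.
have {}qP (i : 'I_n) : {q : rat | `|x ord0 i - ratr q| < k.+1%:R^-1}.
  apply: cid; have [q] := @rat_in_itvoo R (x ord0 i - k.+1%:R^-1) (x ord0 i + k.+1%:R^-1)
    ltac:(by rewrite ltrD2l gt0_cp).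
  rewrite in_itv/= => /andP[q1 q2]; exists q.
  by move: q1 q2; move: (ratr q) (k.+1%:R^-1) => q' r' ? ?; rewrite ltr_norml; apply/andP; split; lra.
exists (\row_i sval (qP i), k) => /=.
  by move=> i; rewrite !mxE; case: (qP i).
move=> y yq; apply: eA; split=> // i j; rewrite ord1 /ball /=.
have := yq j; rewrite !mxE; case: (qP j) => /= q xq yq'.
rewrite (_ : x _ _ - y _ _ = (x ord0 j - ratr q) - (y ord0 j - ratr q)); last by ring.
apply: (le_lt_trans (ler_normB _ _)).
by move: xq yq' ke; move: (k.+1%:R^-1) => r'; lra.
Qed.

Lemma open_bigcup_rat_cube A : open A ->
  A = \bigcup_(p in [set p | rat_cube p `<=` A]) rat_cube p.
Proof.
move=> oA; apply/seteqP; split=> [x /(open_rat_cube oA)[p px pA]|].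
  by exists p.
by apply: bigcup_sub => p.
Qed.

Lemma open_measurable_rV A : open A -> measurable A.
Proof.
move=> /open_bigcup_rat_cube ->; rewrite bigcup_mkcond.
apply: countable_bigcupT_measurable => // p.
by case: ifP => _ //; exact: measurable_cube.
Qed.

Lemma continuous_measurable_rV (f : 'rV[R]_n -> R) : continuous f ->
  measurable_fun [set: 'rV[R]_n] f.
Proof.
move=> cf; apply: (measurability _ (RGenOpens.measurableE R)).
move=> _ [_ [a [b ->] <-]]; rewrite setTI; apply: open_measurable_rV.
by move/continuousP : cf; apply; exact: interval_open.
Qed.

(** Open sets are countable unions of rational cubes, so they belong to [S]. The coordinates, which
    generate the Borel structure, are then measurable for [S], and with them the identity map; its
    measurability is the claim. *)
Lemma sigma_algebra_rat_cube (S : set (set 'rV[R]_n)) :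
  sigma_algebra setT S -> (forall p, S (rat_cube p)) -> measurable `<=` S.
Proof.
move=> sS Scube.
pose T' := g_sigma_algebraType S.
have SE : <<s S >> = S by exact: sigma_algebra_id.
have cubeT p : @measurable _ T' (rat_cube p) by exact: sub_sigma_algebra.
have openT A : open A -> @measurable _ T' A.
  move=> /open_bigcup_rat_cube ->; rewrite bigcup_mkcond.
  by apply: (@countable_bigcupT_measurable _ T') => // p; case: ifP => _ //; exact: cubeT.
have /= idT : measurable_fun [set: T'] (id : T' -> 'rV[R]_n).
  apply: measurable_fun_rV => i; apply: (measurability _ (RGenOpens.measurableE R)).
  move=> _ [_ [a [b ->] <-]]; rewrite setTI; apply: openT.
  by apply: open_comp; [move=> ? _; exact: coord_continuous|exact: interval_open].
move=> A mA; rewrite -SE.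
by have := idT measurableT A mA; rewrite setTI preimage_id.
Qed.

End rV_borel.

(** * Translation invariance of Lebesgue measure on R^n *)

Section translation.
Context {R : realType}.

(** Lebesgue measure is determined by its values on half-open intervals, whose length a translation
    keeps. *)
Lemma lebesgue_measure_translation (c : R) (A : set R) : measurable A ->
  lebesgue_measure ((fun x => x + c) @^-1` A) = lebesgue_measure A.
Proof.
move=> mA; have mc : measurable_fun [set: measurableTypeR R]
    ((fun x => x + c) : _ -> measurableTypeR R) by exact: measurable_funD.
pose f : {mfun measurableTypeR R >-> measurableTypeR R} :=
  HB.pack (fun x : measurableTypeR R => x + c : measurableTypeR R) (isMeasurableFun.Build _ _ _ _ _ mc).
suff /(_ _ mA) -> : forall B, measurable B ->
  lebesgue_measure B = pushforward (@lebesgue_measure R) f B by [].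
apply: lebesgue_measure_unique => //= _ [[a b]] _ <-.
rewrite /pushforward /=.
rewrite (_ : _ @^-1` _ = `]a - c, b - c]%classic); last first.
  by apply/seteqP; split=> x /=; rewrite !in_itv/= => /andP[? ?]; apply/andP; split; lra.
by rewrite !lebesgue_measure_itv/= !lte_fin ltrD2r -!EFinB; case: ifP => // _; congr EFin; ring.
Qed.

Lemma measurable_translation_rV n (v : 'rV[R]_n) :
  measurable_fun [set: 'rV[R]_n] (fun x : 'rV[R]_n => x + v).
Proof.
apply: measurable_fun_rV => i; under eq_fun do rewrite mxE.
by apply: measurable_funD => //; exact: measurable_coord.
Qed.

(** Induction on the dimension through sections of [A]: the induction hypothesis removes the shift
    of the last coordinates inside the outer integral, and the one-dimensional invariance removes
    the shift of the first one. *)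
Lemma lebesgue_rV_translation n (v : 'rV[R]_n) (A : set 'rV[R]_n) :
  measurable A ->
  lebesgue_rV R n ((fun x => x + v) @^-1` A) = lebesgue_rV R n A.
Proof.
elim: n v A => [|n IHn] v A mA.
  congr (lebesgue_rV R 0 _); apply/seteqP.
  by split=> x /=; rewrite (_ : x + v = x)//; apply/rowP => -[].
rewrite /= /lebesgue_step /pushforward.
pose w : 'rV[R]_n := \row_i v ord0 (lift ord0 i).
have consD (s : R) y : rV_cons (s, y) + v = rV_cons (s + v ord0 ord0, y + w).
  apply/rowP => j; rewrite !mxE.
  by case: unliftP => [k ->|->] /=; rewrite ?mxE.
set B := @rV_cons R n @^-1` A.
have mB : measurable B.
  by rewrite /B -[X in measurable X]setTI; exact: measurable_rV_cons.
have -> : @rV_cons R n @^-1` ((fun x => x + v) @^-1` A) =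
   [set p : R * 'rV[R]_n | B (p.1 + v ord0 ord0, p.2 + w)].
  by apply/seteqP; split=> -[s y] /=; rewrite consD.
rewrite /product_measure1.
rewrite /=.
under eq_integral => s _.
  rewrite (_ : xsection _ s =
    (fun y => y + w) @^-1` (xsection B (s + v ord0 ord0))); last first.
    by apply/seteqP; split=> y; rewrite /xsection/= !inE.
  rewrite IHn; last exact: measurable_xsection.
  over.
set f := fun s => lebesgue_rV R n (xsection B s).
have mf : measurable_fun [set: measurableTypeR R] f by exact: measurable_fun_xsection.
have mc : measurable_fun [set: measurableTypeR R]
    ((fun x => x + v ord0 ord0) : _ -> measurableTypeR R) by exact: measurable_funD.
pose c : measurableTypeR R -> measurableTypeR R := fun x => x + v ord0 ord0.
transitivity (\int[pushforward (@lebesgue_measure R) c]_s f s)%E.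
  rewrite ge0_integral_pushforward// => *; exact: measure_ge0.
apply: eq_measure_integral => //= C mC _; exact: lebesgue_measure_translation.
Qed.

Section integral_translation.
Context {n : nat}.
Notation mu := (lebesgue_rV R n).
Implicit Types (v : 'rV[R]_n) (f : 'rV[R]_n -> R).

Let pushforward_translation v (g : 'rV[R]_n -> \bar R) :
  (\int[pushforward mu (fun x : 'rV[R]_n => (x + v)%R)]_x g x = \int[mu]_x g x)%E.
Proof.
apply: eq_measure_integral => [|/= _ C mC _]; first exact: measurable_translation_rV.
exact: lebesgue_rV_translation.
Qed.

Lemma integrable_translation v f : mu.-integrable setT (EFin \o f) ->
  mu.-integrable setT (EFin \o (fun x => f (x + v))).
Proof.
move=> intf; have mt := @measurable_translation_rV n v.
have mf : measurable_fun [set: 'rV[R]_n] (EFin \o f) by exact: measurable_int intf.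
apply/integrableP; split; first exact: (measurableT_comp mf mt).
have /integrableP[_] := intf; rewrite -(pushforward_translation v).
by rewrite ge0_integral_pushforward//; exact: measurableT_comp.
Qed.

Lemma Rintegral_translation v f : mu.-integrable setT (EFin \o f) ->
  (\int[mu]_x f (x + v) = \int[mu]_x f x)%R.
Proof.
move=> intf; have mt := @measurable_translation_rV n v.
have mf : measurable_fun [set: 'rV[R]_n] (EFin \o f) by exact: measurable_int intf.
rewrite /Rintegral; congr fine; rewrite -[RHS](pushforward_translation v).
by rewrite integral_pushforward ?preimage_setT//; exact: integrable_translation.
Qed.

End integral_translation.

End translation.

(** * Test functions *)

Section flat.
Context {R : realType}.
Implicit Types (p : {poly R}) (x y : R).

(* The derivative of p(1/x) exp(-1/x) is q(1/x) exp(-1/x), with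
   q = X^2 (p - p'): the functions [flat p] are closed under derivation. *)
Definition flat p x : R := if 0 < x then p.[x^-1] * expR (- x^-1) else 0.

(** The term [|p(y)| y y^k] falls under the bound for [p] at [k + 1], which is why [k] varies in the
    induction; the constant coefficient is handled by [y^k <= k! e^y]. *)
Lemma horner_expR_bound p k : exists2 C, 0 <= C &
  forall y, 0 <= y -> `|p.[y]| * y ^+ k * expR (- y) <= C.
Proof.
elim/poly_ind: p k => [|p c IH] k.
  by exists 0 => // y _; rewrite horner0 normr0 !mul0r.
have [C C0 HC] := IH k.+1.
exists (C + `|c| * k`!%:R) => [|y y0].
  by rewrite addr_ge0// mulr_ge0.
have ek : y ^+ k * expR (- y) <= k`!%:R.
  rewrite expRN ler_pdivrMr ?expR_gt0//.
  case: k {IH HC} => [|k].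
    by rewrite expr0 fact0 mul1r (le_trans _ (expR_ge1Dx y))// lerDl.
  rewrite mulrC -ler_pdivrMr ?ltr0n ?fact_gt0//.
  by apply: le_trans (expR_ge1Dxn k y0); rewrite lerDr.
have e0 := expR_ge0 (- y); have yk0 : 0 <= y ^+ k by exact: exprn_ge0.
apply: (@le_trans _ _ ((`|p.[y]| * y + `|c|) * y ^+ k * expR (- y))).
  rewrite hornerMXaddC -!mulrA ler_wpM2r ?mulr_ge0//.
  by rewrite (le_trans (ler_normD _ _))// normrM (ger0_norm y0).
have := HC y y0; rewrite exprS mulrA => HCy.
by rewrite !mulrDl lerD// -mulrA ler_wpM2l.
Qed.

(** Order two at the origin is what forces the derivative there to be 0; it is the previous bound at
    [k = 2] and [y = 1/x]. *)
Lemma flat_bound p : exists2 C, 0 <= C & forall x, `|flat p x| <= C * x ^+ 2.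
Proof.
have [C C0 HC] := horner_expR_bound p 2.
exists C => // x; rewrite /flat; case: ifPn => [x0|_]; last first.
  by rewrite normr0 mulr_ge0// sqr_ge0.
have := HC x^-1; rewrite invr_ge0 ltW// => /(_ isT).
rewrite normrM (ger0_norm (expR_ge0 _)) exprVn mulrAC ler_pdivrMr//.
by rewrite exprn_gt0.
Qed.

Lemma is_derive_flat p x :
  is_derive x 1 (flat p) (flat ('X^2 * (p - p^`())) x).
Proof.
have [x0|x0|->] := ltgtP x 0.
- rewrite [flat _ x](_ : _ = 0); last by rewrite /flat ltNge (ltW x0).
  have := is_derive_cst (0 : R) x 1; apply: near_eq_is_derive.
  by near=> y; rewrite /flat ltNge ltW//=; near: y; exact: lt_nbhsl.
- apply: (@near_eq_is_derive _ _ _ (fun y => p.[y^-1] * expR (- y^-1))).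
    near=> y; rewrite /flat ifT//; near: y; exact: lt_nbhsr.
  have xn0 : x != 0 by rewrite gt_eqF.
  have dV : is_derive x 1 (fun y : R => y^-1) (- x ^- 2).
    by have := @is_deriveV _ id x 1 1 xn0 (is_derive_id _ _); rewrite [_%:A]mulr1.
  have dp : is_derive x^-1 1 (horner p) p^`().[x^-1].
    by apply: DeriveDef; [exact: derivable_horner|rewrite -derive1E -derivE].
  have d1 := @is_derive1_comp _ (horner p) _ x _ _ dp dV.
  have d2 := @is_derive1_comp _ expR _ x _ _ (is_derive_expR _) (is_deriveN dV).
  have [H1 H2] := is_deriveM d1 d2; apply: DeriveDef; first exact: H1.
  etransitivity; first exact: H2.
  rewrite /flat x0 !hornerE /= exprVn /GRing.scale/=; ring.
- have [C C0 HC] := flat_bound p.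
  have f0 q : flat q 0 = 0 by rewrite /flat ltxx.
  have cv : h^-1 *: ((flat p \o shift (0:R)) (h *: 1) - flat p 0) @[h --> 0^'] --> (0:R).
    apply/cvgr0Pnorm_lt => e e0; near=> h.
    rewrite /= f0 subr0 addr0 [_%:A]mulr1 normrM normfV.
    have h0 : h != 0 by near: h; exact: nbhs_dnbhs_neq.
    rewrite mulrC ltr_pdivrMr ?normr_gt0// (le_lt_trans (HC h))//.
    rewrite -(real_normK (num_real h)) expr2 mulrA ltr_pM2r ?normr_gt0//.
    (* [C] may be 0, hence the [C + 1] in the denominator. *)
    have : `|h| < e / (C + 1).
      near: h; apply: dnbhs0_lt; by rewrite divr_gt0// ltr_pwDr.
    rewrite ltr_pdivlMr ?ltr_pwDr// => hC; apply: le_lt_trans hC.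
    by rewrite mulrC ler_wpM2l// lerDl.
  by rewrite f0; apply: DeriveDef; [apply/cvg_ex; exists 0|exact: cvg_lim cv].
Unshelve. all: by end_near. Qed.

Lemma flat1_ge0 x : 0 <= flat 1 x.
Proof. by rewrite /flat; case: ifP => // _; rewrite hornerE mul1r expR_ge0. Qed.

Lemma flat1_neq0 x : (flat 1 x != 0) = (0 < x).
Proof.
by rewrite /flat; case: ifP; rewrite ?eqxx// hornerE mul1r gt_eqF ?expR_gt0.
Qed.

End flat.

(** * Explicit smooth functions and bump functions *)

Section smooth_expr.
Context {R : realType} {n : nat}.
Implicit Types (f g : 'rV[R]_n -> R) (x v : 'rV[R]_n) (i j : 'I_n).

(* Closed under partial derivatives, which makes every member smooth. *)
Inductive smooth_expr : ('rV[R]_n -> R) -> Prop :=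
| smooth_expr_cst c : smooth_expr (fun=> c)
| smooth_expr_flat p i s c : smooth_expr (fun x => flat p (s * x ord0 i + c))
| smooth_exprD f g : smooth_expr f -> smooth_expr g ->
    smooth_expr (fun x => f x + g x)
| smooth_exprM f g : smooth_expr f -> smooth_expr g ->
    smooth_expr (fun x => f x * g x)
| smooth_exprV f : smooth_expr f -> (forall x, f x != 0) ->
    smooth_expr (fun x => (f x)^-1).

Lemma differentiable_flat_coord p i s c x :
  differentiable (fun x => flat p (s * x ord0 i + c)) x.
Proof.
apply: (@differentiable_comp _ _ _ _ (fun x => s * x ord0 i + c) (flat p)).
  apply: differentiableD => //; apply: differentiableM => //.
  exact: differentiable_coord.
by apply/derivable1_diffP; have [] := is_derive_flat p (s * x ord0 i + c).
Qed.

Lemma smooth_expr_differentiable f x : smooth_expr f -> differentiable f x.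
Proof.
elim=> [c|p i s c|{}f g _ df _ dg|{}f g _ df _ dg|{}f _ df f0].
- exact: differentiable_cst.
- exact: differentiable_flat_coord.
- exact: differentiableD.
- exact: differentiableM.
- exact: differentiableV.
Qed.

Lemma derive_flat_coord p i s c x v :
  'D_v (fun x => flat p (s * x ord0 i + c)) x =
  s * v ord0 i * flat ('X^2 * (p - p^`())) (s * x ord0 i + c).
Proof.
have dl : differentiable (fun x : 'rV[R]_n => s * x ord0 i + c) x.
  apply: differentiableD => //; apply: differentiableM => //.
  exact: differentiable_coord.
have [dp dpE] := is_derive_flat p (s * x ord0 i + c).
rewrite deriveE; last exact: differentiable_flat_coord.
have /= -> := @diff_comp _ _ _ _ (fun x => s * x ord0 i + c) (flat p) x dl
  ((derivable1_diffP _ _).1 dp).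
rewrite /= diff1E; last exact/derivable1_diffP.
rewrite derive1E dpE -deriveE// [LHS]/GRing.scale/=; congr (_ * _).
apply: cvg_lim => //; apply: cvg_near_cst; near=> h.
have h0 : h != 0 by near: h; exact: nbhs_dnbhs_neq.
by rewrite /= !mxE /GRing.scale/=; field.
Unshelve. all: by end_near. Qed.

Lemma smooth_expr_partial f i : smooth_expr f -> smooth_expr (partial i f).
Proof.
move=> sf; have df g x : smooth_expr g -> derivable g x (delta_mx ord0 i).
  by move=> sg; apply: diff_derivable; exact: smooth_expr_differentiable.
elim: sf => [c|p j s c|{}f g sf pf sg pg|{}f g sf pf sg pg|{}f sf pf f0].
- rewrite (_ : partial i _ = (fun=> 0)); first exact: smooth_expr_cst.
  by apply/funext => x; rewrite /partial derive_cst.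
- rewrite (_ : partial i _ = fun x => s * (delta_mx ord0 i : 'rV[R]_n) ord0 j *
     flat ('X^2 * (p - p^`())) (s * x ord0 j + c)).
    by apply: smooth_exprM; [exact: smooth_expr_cst|exact: smooth_expr_flat].
  by apply/funext => x; rewrite /partial derive_flat_coord.
- rewrite (_ : partial i _ = fun x => partial i f x + partial i g x).
    exact: smooth_exprD.
  by apply/funext => x; rewrite /partial (@deriveD _ _ _ f g)//; exact: df.
- rewrite (_ : partial i _ = fun x => f x * partial i g x + g x * partial i f x).
    by apply: smooth_exprD; exact: smooth_exprM.
  by apply/funext => x; rewrite /partial (@deriveM _ _ f g)//; exact: df.
- rewrite (_ : partial i _ = fun x => -1 * ((f x)^-1 * (f x)^-1) * partial i f x).
    have sV := smooth_exprV sf f0; apply: smooth_exprM => //.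
    apply: smooth_exprM; first exact: smooth_expr_cst.
    exact: smooth_exprM.
  apply/funext => x; rewrite /partial deriveV//; last exact: df.
  by rewrite /GRing.scale/= expr2 invfM mulN1r.
Qed.

Lemma smooth_expr_smooth f : smooth_expr f -> smooth f.
Proof.
move=> sf s; suff {}sf' : smooth_expr (iter_partial s f).
  split=> [x|i x]; last by apply: diff_derivable; exact: smooth_expr_differentiable.
  by apply: differentiable_continuous; exact: smooth_expr_differentiable.
by elim: s => //= i s; exact: smooth_expr_partial.
Qed.

Lemma smooth_expr_continuous f : smooth_expr f -> continuous f.
Proof. by move=> /smooth_expr_smooth /(_ [::])[]. Qed.

Lemma smooth_expr_translation f v : smooth_expr f ->
  smooth_expr (fun x => f (x + v)).
Proof.
elim=> [c|p i s c|{}f g _ df _ dg|{}f g _ df _ dg|{}f _ df f0].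
- exact: smooth_expr_cst.
- under eq_fun do rewrite mxE mulrDr -addrA; exact: smooth_expr_flat.
- exact: smooth_exprD.
- exact: smooth_exprM.
- exact: smooth_exprV.
Qed.

Lemma smooth_expr_prod (F : 'I_n -> 'rV[R]_n -> R) :
  (forall i, smooth_expr (F i)) -> smooth_expr (fun x => \prod_i F i x).
Proof.
move=> sF; elim: (index_enum _) => [|i s IH].
  by under eq_fun do rewrite big_nil; exact: smooth_expr_cst.
by under eq_fun do rewrite big_cons; exact: smooth_exprM.
Qed.

(* A class of test functions large enough to be dense in L^2. *)
Definition bump_expr : set ('rV[R]_n -> R) := [set f | smooth_expr f /\
  exists M, forall x, f x != 0 -> forall i, `|x ord0 i| <= M].

Lemma bump_exprM f g : bump_expr f -> smooth_expr g ->
  bump_expr (fun x => f x * g x).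
Proof.
move=> [sf [M fM]] sg; split; first exact: smooth_exprM.
by exists M => x; rewrite mulf_eq0 negb_or => /andP[/fM].
Qed.

Lemma bump_exprZ f c : bump_expr f -> bump_expr (fun x => c * f x).
Proof.
move=> bf; under eq_fun do rewrite mulrC.
by apply: bump_exprM => //; exact: smooth_expr_cst.
Qed.

Lemma bump_exprD f g : bump_expr f -> bump_expr g ->
  bump_expr (fun x => f x + g x).
Proof.
move=> [sf [M fM]] [sg [N gN]]; split; first exact: smooth_exprD.
exists (Num.max M N) => x fg0 i; rewrite le_max.
have [f0|/fM/(_ i)->//] := eqVneq (f x) 0.
by move: fg0; rewrite f0 add0r => /gN/(_ i)->; rewrite orbT.
Qed.

Lemma bump_expr0 : bump_expr (fun=> 0).
Proof. by split; [exact: smooth_expr_cst|exists 0 => x; rewrite eqxx]. Qed.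

Lemma rV_coord_le_norm v i : `|v ord0 i| <= `|v|.
Proof.
rewrite [leRHS]/Num.norm/= mx_normrE.
exact: (le_bigmax _ (fun i : 'I_1 * 'I_n => `|v i.1 i.2|) (ord0, i)).
Qed.

Lemma bump_expr_translation f v : bump_expr f -> bump_expr (fun x => f (x + v)).
Proof.
move=> [sf [M fM]]; split; first exact: smooth_expr_translation.
exists (M + `|v|) => x /fM xM i.
have := xM i; rewrite mxE => {}xM; have := ler_normB (x ord0 i + v ord0 i) (v ord0 i).
by rewrite addrK => /le_trans; apply; rewrite lerD// rV_coord_le_norm.
Qed.

Lemma partial_eq0 f i x (A : set 'rV[R]_n) : open A -> A x ->
  (forall y, A y -> f y = 0) -> partial i f x = 0.
Proof.
move=> oA Ax f0; rewrite /partial (@near_eq_derive _ _ _ f (cst 0)) ?derive_cst//.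
by near=> y; apply: f0; near: y; exact: open_nbhs_nbhs.
Unshelve. all: by end_near. Qed.

Lemma open_coord_gt i M : open [set x : 'rV[R]_n | M < `|x ord0 i|].
Proof.
apply: (@open_comp _ _ (fun x : 'rV[R]_n => `|x ord0 i|) [set y | M < y]).
  move=> x _; apply: (@continuous_comp _ _ _ (fun x : 'rV[R]_n => x ord0 i)).
    exact: coord_continuous.
  exact: norm_continuous.
exact: open_gt.
Qed.

Lemma bump_expr_partial f i : bump_expr f -> bump_expr (partial i f).
Proof.
move=> [sf [M fM]]; split; first exact: smooth_expr_partial.
exists M => x dfx j; rewrite leNgt; apply: contra dfx => Mx; apply/eqP.
apply: (@partial_eq0 f i x [set y | M < `|y ord0 j|]) => //.
  exact: open_coord_gt.
by move=> y /=; apply: contraTeq => /fM/(_ j); rewrite -leNgt.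
Qed.

Lemma bump_expr_test_function f : bump_expr f -> test_function f.
Proof.
move=> [sf [M fM]]; split; first exact: smooth_expr_smooth.
have cl : closed [set x : 'rV[R]_n | forall i, `|x ord0 i| <= M].
  rewrite (_ : mkset _ = \bigcap_i ~` [set x : 'rV[R]_n | M < `|x ord0 i|]).
    by apply: closed_bigI => i _; apply: open_closedC; exact: open_coord_gt.
  apply/seteqP; split=> x /= H i; first by move=> _ /=; apply/negP; rewrite -leNgt.
  by have /negP := H i I; rewrite -leNgt.
apply: bounded_closed_compact; last exact: closed_closure.
(* [M] may be negative when [f] vanishes identically, but a bound on norms may not. *)
exists (Num.max 0 M); split; first exact: num_real.
move=> N MN x cx; apply/ltW/(le_lt_trans _ MN).
rewrite /Num.norm/= mx_normrE; apply: bigmax_le; first by rewrite le_max lexx.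
move=> [i j] _ /=; rewrite ord1 le_max; apply/orP; right.
suff : closure [set y | f y != 0] `<=` [set x : 'rV[R]_n | forall i, `|x ord0 i| <= M].
  by move=> /(_ _ cx) /(_ j).
rewrite [X in _ `<=` X](closure_id _).1//; apply: closure_subset => y /=; exact: fM.
Qed.

Lemma bump_expr_bounded f : bump_expr f -> exists2 C, 0 <= C & forall x, `|f x| <= C.
Proof.
move=> bf; have [sf ck] := bump_expr_test_function bf.
have cf : continuous f by apply: smooth_expr_continuous; case: bf.
have [M [_ HM]] := compact_bounded (continuous_compact (continuous_subspaceT cf) ck).
exists (Num.max 0 (M + 1)); first by rewrite le_max lexx.
move=> x; rewrite le_max; have [->|fx0] := eqVneq (f x) 0.
  by rewrite normr0 lexx.
apply/orP; right; apply: HM; first by rewrite ltrDl.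
by exists x => //; exact: subset_closure.
Qed.

(** Each coordinate carries one factor per face of the cube, vanishing from that face outwards. *)
Definition cube_bump (q : 'rV[R]_n) r x : R :=
  \prod_i (flat 1 (x ord0 i - q ord0 i + r) * flat 1 (r - (x ord0 i - q ord0 i))).

Lemma cube_bump_ge0 q r x : 0 <= cube_bump q r x.
Proof. by apply: prodr_ge0 => i _; rewrite mulr_ge0// flat1_ge0. Qed.

Lemma cube_bump_neq0 q r x : cube_bump q r x != 0 <-> cube q r x.
Proof.
rewrite /cube_bump prodf_seq_neq0; split=> [/allP H i|H].
  have := H i; rewrite mem_index_enum => /(_ isT).
  rewrite implyTb mulf_eq0 negb_or !flat1_neq0 ltr_norml => /andP[? ?].
  by apply/andP; split; lra.
apply/allP => i _; rewrite implyTb mulf_eq0 negb_or !flat1_neq0.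
by have := H i; rewrite ltr_norml => /andP[? ?]; apply/andP; split; lra.
Qed.

Lemma bump_expr_cube_bump q r : bump_expr (cube_bump q r).
Proof.
split.
  apply: smooth_expr_prod => i; apply: smooth_exprM.
    under eq_fun do rewrite -addrA -[x in x + _](mul1r).
    exact: smooth_expr_flat.
  rewrite (_ : (fun _ => _) = fun x => flat 1 (-1 * x ord0 i + (r + q ord0 i))).
    exact: smooth_expr_flat.
  by apply/funext => x; congr flat; ring.
exists (r + `|q|) => x /cube_bump_neq0 /[swap] i /(_ i) xq.
have := ler_normD (x ord0 i - q ord0 i) (q ord0 i); rewrite subrK => /le_trans; apply.
by rewrite lerD ?(ltW xq)// rV_coord_le_norm.
Qed.

End smooth_expr.

(** * The inner product of L^2 *)

Section square_integrable.
Context d (T : measurableType d) (R : realType) (mu : {measure set T -> \bar R}).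
Implicit Types (f g h : T -> R) (c : R).

(** With [nrm] below, the counterpart of [L2] and [L2norm] over an arbitrary measure; on R^n they
    are convertible to these. *)
Definition sqint f := f \in Lfun mu 2%:E.

Definition ip f g : R := \int[mu]_x (f x * g x).

Definition nrm f : R := fine ('N[mu]_2%:E[EFin \o f])%E.

Lemma sqint_measurable f : sqint f -> measurable_fun [set: T] f.
Proof. by move=> /sub_Lfun_mfun; rewrite inE. Qed.

Lemma sqint_integrable_mul f g : sqint f -> sqint g ->
  mu.-integrable setT (fun x => (f x * g x)%:E).
Proof. by move=> sf sg; apply/Lfun1_integrable; exact: Lfun2_mul_Lfun1. Qed.

Lemma Lnorm2E f :
  ('N[mu]_2%:E[EFin \o f] = (\int[mu]_x (f x * f x)%:E) `^ 2^-1)%E.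
Proof.
rewrite unlock; congr (_ `^ _)%E; apply: eq_integral => x _ /=.
by rewrite powR_mulrn// real_normK ?num_real// expr2.
Qed.

Lemma sqintP f : sqint f <-> measurable_fun [set: T] f /\
  mu.-integrable setT (fun x => (f x * f x)%:E).
Proof.
split=> [sf|[mf /integrableP[_ intf]]].
  by split; [exact: sqint_measurable|exact: sqint_integrable_mul].
rewrite /sqint inE; apply/andP; split; rewrite inE//= /finite_norm Lnorm2E.
rewrite poweR_lty//; apply: le_lt_trans intf.
by under eq_integral do rewrite -[(_ * _)%:E]gee0_abs ?lee_fin -?expr2 ?sqr_ge0//.
Qed.

Lemma sqint_le f g : measurable_fun [set: T] f -> sqint g ->
  (forall x, `|f x| <= `|g x|) -> sqint f.
Proof.
move=> mf /sqintP[mg ig] fg; apply/sqintP; split=> //.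
apply: le_integrable ig => //.
  by apply/measurable_EFinP; exact: measurable_funM.
by move=> x _; rewrite /= lee_fin !normrM ler_pM.
Qed.

Lemma sqint0 : sqint (fun=> 0).
Proof.
apply/sqintP; split; first exact: measurable_cst.
by under eq_fun do rewrite mul0r; exact: integrable0.
Qed.

Lemma sqintZ c f : sqint f -> sqint (fun x => c * f x).
Proof.
move=> /sqintP[mf intf]; apply/sqintP; split; first exact: measurable_funM.
rewrite (_ : (fun _ => _) = fun x => (c * c)%:E * (f x * f x)%:E)%E.
  exact: integrableZl.
by apply/funext => x; rewrite -EFinM mulrACA.
Qed.

Lemma sqintD f g : sqint f -> sqint g -> sqint (fun x => f x + g x).
Proof.
move=> sf sg; apply/sqintP; split.
  by apply: measurable_funD; exact: sqint_measurable.
rewrite (_ : (fun _ => _) = (fun x => (f x * f x)%:E + (f x * g x)%:E +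
    ((f x * g x)%:E + (g x * g x)%:E)))%E.
  by do !apply: integrableD => //; exact: sqint_integrable_mul.
by apply/funext => x; rewrite -!EFinD; congr EFin; ring.
Qed.

Lemma sqintN f : sqint f -> sqint (fun x => - f x).
Proof. by move=> sf; under eq_fun do rewrite -mulN1r; exact: sqintZ. Qed.

Lemma sqintB f g : sqint f -> sqint g -> sqint (fun x => f x - g x).
Proof. by move=> sf sg; apply: sqintD => //; exact: sqintN. Qed.

Lemma ipC f g : ip f g = ip g f.
Proof. by apply: eq_Rintegral => x _; rewrite mulrC. Qed.

Lemma ipDl f g h : sqint f -> sqint g -> sqint h ->
  ip (fun x => f x + g x) h = ip f h + ip g h.
Proof.
move=> sf sg sh; rewrite /ip; under eq_Rintegral do rewrite mulrDl.
by rewrite RintegralD//; exact: sqint_integrable_mul.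
Qed.

Lemma ipZl c f h : sqint f -> sqint h -> ip (fun x => c * f x) h = c * ip f h.
Proof.
move=> sf sh; rewrite /ip; under eq_Rintegral do rewrite -mulrA.
by rewrite RintegralZl//; exact: sqint_integrable_mul.
Qed.

Lemma ipNl f h : sqint f -> sqint h -> ip (fun x => - f x) h = - ip f h.
Proof.
move=> sf sh; rewrite -mulN1r -ipZl//; congr (ip _ h).
by apply/funext => x; rewrite mulN1r.
Qed.

Lemma ipBl f g h : sqint f -> sqint g -> sqint h ->
  ip (fun x => f x - g x) h = ip f h - ip g h.
Proof. by move=> sf sg sh; rewrite ipDl ?ipNl//; exact: sqintN. Qed.

Lemma ipBr f g h : sqint f -> sqint g -> sqint h ->
  ip h (fun x => f x - g x) = ip h f - ip h g.
Proof. by move=> sf sg sh; rewrite ipC ipBl// !(ipC h). Qed.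

Lemma ipDr f g h : sqint f -> sqint g -> sqint h ->
  ip h (fun x => f x + g x) = ip h f + ip h g.
Proof. by move=> sf sg sh; rewrite ipC ipDl// !(ipC h). Qed.

Lemma ipZr c f h : sqint f -> sqint h -> ip h (fun x => c * f x) = c * ip h f.
Proof. by move=> sf sh; rewrite ipC ipZl// (ipC h). Qed.

Lemma ip_ge0 f : 0 <= ip f f.
Proof. by apply: Rintegral_ge0 => x _; rewrite -expr2 sqr_ge0. Qed.

Lemma ip_ae f g h : measurable_fun [set: T] f -> measurable_fun [set: T] g ->
  measurable_fun [set: T] h ->
  {ae mu, forall x, f x = g x} -> ip f h = ip g h.
Proof.
move=> mf mg mh fg; rewrite /ip /Rintegral; congr fine.
apply: ae_eq_integral => //.
- by apply/measurable_EFinP; exact: measurable_funM.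
- by apply/measurable_EFinP; exact: measurable_funM.
- by apply: filterS fg => x /= -> _.
Qed.

Lemma nrm_ge0 f : 0 <= nrm f.
Proof. by apply: fine_ge0; exact: Lnorm_ge0. Qed.

Lemma nrm_sqr f : sqint f -> nrm f ^+ 2 = ip f f.
Proof.
move=> /sqintP[mf intf]; have i0 : (0 <= \int[mu]_x (f x * f x)%:E)%E.
  by apply: integral_ge0 => x _; rewrite lee_fin -expr2 sqr_ge0.
rewrite /nrm Lnorm2E /ip /Rintegral.
have /integral_fune_fin_num := intf => /(_ measurableT)/fineK <-.
by rewrite poweR_EFin/= powR12_sqrt ?fine_ge0// sqr_sqrtr ?fine_ge0.
Qed.

Lemma cauchy_schwarz f g : sqint f -> sqint g -> `|ip f g| <= nrm f * nrm g.
Proof.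
move=> sf sg; rewrite /ip -lee_fin.
apply: (@le_trans _ _ (\int[mu]_x `|f x * g x|)%:E).
  by rewrite lee_fin; apply: le_normr_Rintegral => //; exact: sqint_integrable_mul.
have fin h : sqint h -> ('N[mu]_2%:E[EFin \o h] \is a fin_num)%E.
  by move=> /sub_Lfun_finLfun; rewrite inE/= ge0_fin_numE// Lnorm_ge0.
rewrite EFinM /nrm !fineK ?fin//; last first.
  have := integrable_norm (sqint_integrable_mul sf sg) => ?.
  exact: integral_fune_fin_num.
have := @hoelder _ _ _ mu f g 2 2; rewrite Lnorm1; apply => //.
- exact: sqint_measurable.
- exact: sqint_measurable.
- by rewrite [RHS]splitr !div1r.
Qed.

Lemma nrmZ c f : sqint f -> nrm (fun x => c * f x) = `|c| * nrm f.
Proof.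
move=> sf; apply/eqP; rewrite -(@eqrXn2 _ 2)// ?mulr_ge0 ?nrm_ge0//.
rewrite exprMn !nrm_sqr// ?sqintZ// ipZl// ?ipZr//; last exact: sqintZ.
by rewrite mulrA real_normK ?num_real.
Qed.

Lemma nrmD f g : sqint f -> sqint g -> nrm (fun x => f x + g x) <= nrm f + nrm g.
Proof.
move=> sf sg; have sfg := sqintD sf sg.
rewrite -(@ler_pXn2r _ 2)// ?nnegrE ?addr_ge0 ?nrm_ge0//.
rewrite sqrrD !nrm_sqr// ipDl// !ipDr//.
have := ler_norm (ip f g); have := cauchy_schwarz sf sg.
rewrite (ipC g f); lra.
Qed.

Lemma nrmN f : nrm (fun x => - f x) = nrm f.
Proof. by rewrite /nrm -[in RHS]oppe_Lnorm. Qed.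

Lemma nrm_distC f g : nrm (fun x => f x - g x) = nrm (fun x => g x - f x).
Proof. by rewrite -nrmN; under eq_fun do rewrite opprB. Qed.

Lemma nrm_trans g f h : sqint f -> sqint g -> sqint h ->
  nrm (fun x => f x - h x) <= nrm (fun x => f x - g x) + nrm (fun x => g x - h x).
Proof.
move=> sf sg sh; rewrite (_ : (fun x => f x - h x) =
    fun x => (f x - g x) + (g x - h x)).
  by apply: nrmD; exact: sqintB.
by apply/funext => x; rewrite addrA subrK.
Qed.

(** Dominated convergence for the squares: [f_ k] and its limit are both bounded by [g], so
    [(f_ k - f)^2 <= 4 g^2], which is integrable. *)
Lemma sqint_dominated_cvg (f_ : (T -> R)^nat) f g :
  (forall k, measurable_fun [set: T] (f_ k)) ->
  (forall x, f_ ^~ x @ \oo --> f x) ->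
  sqint g -> (forall k x, `|f_ k x| <= g x) ->
  sqint f /\ nrm (fun x => f_ k x - f x) @[k --> \oo] --> (0 : R).
Proof.
move=> mf_ f_f sg f_g.
have mf : measurable_fun [set: T] f.
  by apply: (measurable_fun_cvg mf_) => x _; exact: f_f.
have g0 x : 0 <= g x by rewrite (le_trans _ (f_g 0%N x)).
have fg x : `|f x| <= g x.
  apply: (cvgr_to_le (cvg_norm (f_f x))); exact: nearW.
have sf : sqint f by apply: sqint_le sg _ => // x; rewrite (ger0_norm (g0 _)).
have sf_ k : sqint (f_ k) by apply: sqint_le sg _ => // x; rewrite (ger0_norm (g0 _)).
split=> //.
have s0 : (\int[mu]_x ((f_ k x - f x) * (f_ k x - f x))%:E)%E @[k --> \oo]
    --> (\int[mu]_x (cst 0 x)%:E)%E.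
  apply: (@dominated_cvg _ _ _ _ _ _ (fun k x => ((f_ k x - f x) * (f_ k x - f x))%:E)
     _ (fun x => (4 * (g x * g x))%:E)) => //.
  - move=> k; apply/measurable_EFinP; apply: measurable_funM; exact: measurable_funB.
  - move=> x _; apply/cvg_EFin; first exact: nearW.
    rewrite /= -[X in _ --> X](mulr0 0); apply: cvgM; apply/subr_cvg0; exact: f_f.
  - under eq_fun do rewrite EFinM; apply: integrableZl => //.
    exact: sqint_integrable_mul.
  - move=> k x _; rewrite abse_EFin lee_fin normrM.
    have := f_g k x; have := fg x; have := ler_normB (f_ k x) (f x) => h1 h2 h3.
    rewrite (_ : 4 * _ = (2 * g x) * (2 * g x)); last by ring.
    by apply: ler_pM => //; lra.
have {}s0 : ip (fun x => f_ k x - f x) (fun x => f_ k x - f x) @[k --> \oo] --> (0 : R).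
  by rewrite integral0 in s0; move/fine_cvgP : s0 => [].
apply: (@squeeze_cvgr _ _ _ _ (cst 0) (fun k => Num.sqrt (ip (fun x => f_ k x - f x) (fun x => f_ k x - f x)))).
- apply: nearW => k; rewrite nrm_ge0/= -nrm_sqr; last exact: sqintB.
  by rewrite sqrtr_sqr ler_norm.
- exact: cvg_cst.
- by rewrite -(@sqrtr0 R); apply: (continuous_cvg _ (@sqrt_continuous R 0)).
Qed.

End square_integrable.

(** * Density of test functions in L^2 *)

Section density.
Import HBNNSimple.
Context {R : realType} {n : nat}.
Notation mu := (lebesgue_rV R n).
Implicit Types (f g phi : 'rV[R]_n -> R) (A : set 'rV[R]_n).

Lemma lebesgue_cube_lty (q : 'rV[R]_n) r : (mu (cube q r) < +oo)%E.
Proof.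
(* [r] may be negative, and the volume formula for boxes needs ordered endpoints. *)
pose a := \row_i (q ord0 i - `|r|); pose b := \row_i (q ord0 i + `|r|).
pose B := [set x : 'rV[R]_n | forall i, a ord0 i <= x ord0 i <= b ord0 i].
have mB : measurable B.
  rewrite (_ : B = \bigcap_(i in [set: 'I_n]) ((fun x : 'rV[R]_n => x ord0 i) @^-1`
      `[a ord0 i, b ord0 i]%classic)); last first.
    apply/seteqP; split=> x /= Bx i; last by have := Bx i I; rewrite /= in_itv.
    by rewrite /= in_itv /=.
  apply: fin_bigcap_measurable => // i _.
  by rewrite -[X in measurable X]setTI; exact: measurable_coord.
have qB : cube q r `<=` B.
  move=> x qx i; have := qx i; have := ler_norm r; rewrite !mxE ltr_norml.
  by move=> ? /andP[? ?]; apply/andP; split; lra.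
apply: (@le_lt_trans _ _ (mu B)).
  by apply: le_measure; rewrite ?inE//; exact: measurable_cube.
rewrite lebesgue_rV_box ?ltry// => i; rewrite !mxE.
by have := normr_ge0 r; lra.
Qed.

Lemma sqint_indic A : measurable A -> (mu A < +oo)%E -> sqint mu \1_A.
Proof.
move=> mA fA; apply/sqintP; split; first exact: measurable_indic.
rewrite (_ : (fun _ => _) = EFin \o \1_A).
  apply/integrableP; split; first exact/measurable_EFinP/measurable_indic.
  under eq_integral do rewrite /= normr_nat.
  by rewrite integral_indic ?setIT.
by apply/funext => x; rewrite /= indicE -natrM mulnb andbb.
Qed.

Lemma bump_expr_sqint phi : bump_expr phi -> sqint mu phi.
Proof.
move=> bphi; have [C C0 HC] := bump_expr_bounded bphi.
have [sphi [M HM]] := bphi.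
have sg : sqint mu (fun x => C * \1_(cube 0 (M + 1)) x).
  apply: sqintZ; apply: sqint_indic; [exact: measurable_cube|exact: lebesgue_cube_lty].
apply: sqint_le sg _.
  by apply: continuous_measurable_rV; exact: smooth_expr_continuous.
move=> x; have [->|px] := eqVneq (phi x) 0; first by rewrite normr0.
rewrite indicE mem_set; first by rewrite mulr1 (ger0_norm C0).
by move=> i; rewrite mxE subr0 (le_lt_trans (HM _ px i))// ltrDl.
Qed.

Lemma continuous_open_neq0 f : continuous f -> open [set x | f x != 0].
Proof.
move=> cf; apply: (@open_comp _ _ f [set y | y != 0]); last exact: open_neq.
by move=> x _; exact: cf.
Qed.

(** The L^2 closure of the bump functions, as a predicate whose stability under linear combinations
    and dominated limits feeds a monotone class argument. *)
Definition bump_limit f := sqint mu f /\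
  forall e, 0 < e -> exists2 phi, bump_expr phi & nrm mu (fun x => f x - phi x) < e.

Lemma bump_expr_limit phi : bump_expr phi -> bump_limit phi.
Proof.
move=> bphi; have sphi := bump_expr_sqint bphi.
split=> // e e0; exists phi => //.
rewrite (_ : (fun _ => _) = fun x => 0 * phi x).
  by rewrite nrmZ// normr0 mul0r.
by apply/funext => x; rewrite subrr mul0r.
Qed.

Lemma bump_limitD f g : bump_limit f -> bump_limit g ->
  bump_limit (fun x => f x + g x).
Proof.
move=> [sf fP] [sg gP]; split; first exact: sqintD.
move=> e e0; have e20 : 0 < e / 2 by rewrite divr_gt0.
have [phi bphi fphi] := fP _ e20; have [psi bpsi gpsi] := gP _ e20.
exists (fun x => phi x + psi x); first exact: bump_exprD.
rewrite (_ : (fun _ => _) = fun x => (f x - phi x) + (g x - psi x)).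
  apply: le_lt_trans (nrmD _ _) _; last by lra.
    by apply: sqintB => //; exact: bump_expr_sqint.
  by apply: sqintB => //; exact: bump_expr_sqint.
by apply/funext => x; ring.
Qed.

Lemma bump_limitZ c f : bump_limit f -> bump_limit (fun x => c * f x).
Proof.
move=> [sf fP]; split; first exact: sqintZ.
move=> e e0; have c0 : 0 < `|c| + 1 by rewrite ltr_pwDr.
have [phi bphi fphi] := fP _ (divr_gt0 e0 c0).
exists (fun x => c * phi x); first exact: bump_exprZ.
rewrite (_ : (fun _ => _) = fun x => c * (f x - phi x)); last first.
  by apply/funext => x; rewrite mulrBr.
rewrite nrmZ; last by apply: sqintB => //; exact: bump_expr_sqint.
move: fphi; rewrite ltr_pdivlMr//; apply: le_lt_trans.
by rewrite mulrC ler_wpM2l ?nrm_ge0// lerDl.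
Qed.

Lemma bump_limitB f g : bump_limit f -> bump_limit g ->
  bump_limit (fun x => f x - g x).
Proof.
move=> bf bg; under eq_fun do rewrite -mulN1r.
by apply: bump_limitD => //; exact: bump_limitZ.
Qed.

Lemma bump_limit_dominated (f_ : ('rV[R]_n -> R)^nat) f g :
  (forall k, bump_limit (f_ k)) -> (forall x, f_ ^~ x @ \oo --> f x) ->
  sqint mu g -> (forall k x, `|f_ k x| <= g x) -> bump_limit f.
Proof.
move=> bf_ f_f sg f_g.
have mf_ k : measurable_fun [set: 'rV[R]_n] (f_ k).
  by apply: (@sqint_measurable _ _ _ mu); case: (bf_ k).
have [sf f_0] := sqint_dominated_cvg mf_ f_f sg f_g.
split=> // e e0; have e20 : 0 < e / 2 by rewrite divr_gt0.
have /cvgr0Pnorm_lt/(_ _ e20)[k _ /(_ k (leqnn _))/=] := f_0.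
rewrite (ger0_norm (nrm_ge0 _ _)) => ke.
have [sfk /(_ _ e20)[phi bphi kphi]] := bf_ k.
exists phi => //; have sphi := bump_expr_sqint bphi.
apply: le_lt_trans (nrm_trans sf sfk sphi) _.
by rewrite (nrm_distC _ f); lra.
Qed.

(* k phi / (1 + k phi) increases to the indicator of [phi != 0]. *)
Lemma bump_limit_neq0 phi : bump_expr phi -> (forall x, 0 <= phi x) ->
  bump_limit \1_[set x | phi x != 0].
Proof.
move=> bphi phi0; have [sphi [M HM]] := bphi.
have cphi := smooth_expr_continuous sphi.
set A := [set x | _].
have mA : measurable A.
  by apply: open_measurable_rV; exact: continuous_open_neq0 cphi.
have sA : sqint mu \1_A.
  apply: sqint_indic => //; apply: (@le_lt_trans _ _ (mu (cube 0 (M + 1)))).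
    apply: le_measure; rewrite ?inE//; first exact: measurable_cube.
    by move=> x Ax i; rewrite mxE subr0 (le_lt_trans (HM _ Ax i))// ltrDl.
  exact: lebesgue_cube_lty.
have pos (k : nat) x : 0 < 1 + k.+1%:R * phi x.
  by rewrite ltr_pwDl// mulr_ge0.
apply: (@bump_limit_dominated
  (fun k x => phi x * (k.+1%:R * (1 + k.+1%:R * phi x)^-1)) _ _ _ _ sA).
- move=> k; apply: bump_expr_limit; apply: bump_exprM => //.
  apply: smooth_exprM; first exact: smooth_expr_cst.
  apply: smooth_exprV; last by move=> x; rewrite gt_eqF.
  apply: smooth_exprD; first exact: smooth_expr_cst.
  by apply: smooth_exprM => //; exact: smooth_expr_cst.
- move=> x; rewrite indicE; case: (boolP (x \in A)) => [|] xA.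
    have px : 0 < phi x by rewrite lt_def phi0 andbT; move: xA; rewrite inE.
    apply/subr_cvg0.
    apply: (@squeeze_cvgr _ _ _ _ (fun k => - (phi x)^-1 * harmonic k) (cst 0)).
    + apply: nearW => k.
      rewrite (_ : _ - _ = - (1 + k.+1%:R * phi x)^-1); last first.
        rewrite (_ : true%:R = 1 :> R)// mulrA.
        rewrite (_ : phi x * _ = (1 + k.+1%:R * phi x) - 1); last by rewrite addrC addKr mulrC.
        by rewrite mulrBl mulfV ?gt_eqF// mul1r addrAC subrr sub0r.
      rewrite /= oppr_le0 invr_ge0 (ltW (pos k x)) andbT mulNr lerN2 /harmonic.
      rewrite -invfM lef_pV2 ?posrE ?mulr_gt0//.
      by rewrite mulrC lerDr.
    + rewrite -[X in _ --> X](mulr0 (- (phi x)^-1)).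
      by apply: cvgM; [exact: cvg_cst|exact: cvg_harmonic].
    + exact: cvg_cst.
  have -> : phi x = 0 by apply/eqP; move: xA; rewrite notin_setE /= => /negP/negPn.
  by under eq_fun do rewrite mul0r; exact: cvg_cst.
- move=> k x; rewrite indicE; case: (boolP (x \in A)) => [|] xA.
    rewrite ger0_norm ?mulr_ge0// ?invr_ge0 ?(ltW (pos k x))//.
    rewrite mulrA ler_pdivrMr ?pos// mul1r mulrC lerDr//.
  have -> : phi x = 0 by apply/eqP; move: xA; rewrite notin_setE /= => /negP/negPn.
  by rewrite mul0r normr0.
Qed.

(** Dynkin's pi-lambda argument. The nonvanishing sets of nonnegative bumps are stable under
    intersection, through products, and include the rational cubes, which generate the Borel sets.
    Intersecting with a fixed cube keeps measures finite: the whole space becomes admissible, and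
    the indicator of that cube dominates increasing unions. *)
Lemma bump_limit_indic A r : measurable A -> bump_limit \1_(A `&` cube 0 r).
Proof.
pose G := [set A : set 'rV[R]_n | exists2 phi, bump_expr phi &
  (forall x, 0 <= phi x) /\ A = [set x | phi x != 0]].
pose C : set 'rV[R]_n := cube 0 r.
pose H := [set A : set 'rV[R]_n | measurable A /\ bump_limit \1_(A `&` C)].
have CE : C = [set x | cube_bump 0 r x != 0].
  by apply/seteqP; split=> x; rewrite /= cube_bump_neq0.
have mC : measurable C by exact: measurable_cube.
have sC : sqint mu \1_C by apply: sqint_indic => //; exact: lebesgue_cube_lty.
have GI : setI_closed G.
  move=> _ _ [f bf [f0 ->]] [g bg [g0 ->]].
  exists (fun x => f x * g x); first by apply: bump_exprM => //; case: bg.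
  split=> [x|]; first exact: mulr_ge0.
  by apply/seteqP; split=> x /=; rewrite mulf_eq0 negb_or => /andP.
have Gcube p : G (rat_cube p).
  exists (cube_bump (map_mx ratr p.1) p.2.+1%:R^-1); first exact: bump_expr_cube_bump.
  split=> [x|]; first exact: cube_bump_ge0.
  by apply/seteqP; split=> x; rewrite /= cube_bump_neq0.
have GC : G C.
  exists (cube_bump 0 r); first exact: bump_expr_cube_bump.
  by split=> // x; exact: cube_bump_ge0.
have GH : G `<=` H.
  move=> B GB; split.
    have [f bf [_ ->]] := GB; apply: open_measurable_rV.
    by apply: continuous_open_neq0; apply: smooth_expr_continuous; case: bf.
  by have [f bf [f0 ->]] := GI _ _ GB GC; exact: bump_limit_neq0.
have LH : lambda_system setT H.
  split=> //.
  - split=> //; rewrite setTI CE.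
    by apply: bump_limit_neq0; [exact: bump_expr_cube_bump|move=> x; exact: cube_bump_ge0].
  - move=> A1 A2 A21 [m1 b1] [m2 b2]; split; first exact: measurableD.
    rewrite (_ : \1__ = fun x => \1_(A1 `&` C) x - \1_(A2 `&` C) x :> R).
      exact: bump_limitB.
    apply/funext => x; rewrite !indicE !in_setI !in_setC.
    case: (boolP (x \in A2)) => [xA2|xA2]; last by rewrite /= andbT subr0.
    have -> : x \in A1 by rewrite inE; apply: A21; rewrite inE in xA2.
    by rewrite andbF subrr.
  - move=> F ndF HF; split; first by apply: bigcup_measurable => k _; case: (HF k).
    apply: (@bump_limit_dominated (fun k => \1_(F k `&` C)) _ _ _ _ sC).
    + by move=> k; case: (HF k).
    + move=> x; apply: cvg_near_cst.
      have [[k _ Fkx]|Fx] := pselect ((\bigcup_k F k) x).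
        near=> m; rewrite !indicE !in_setI (_ : x \in F m); last first.
          rewrite inE; move: Fkx; apply/subsetPset/ndF.
          by near: m; exact: nbhs_infty_ge.
        by rewrite (_ : x \in \bigcup_k F k)// inE; exists k.
      near=> m; have Fmx : ~ F m x by move=> Fmx; apply: Fx; exists m.
      by rewrite !indicE !in_setI (memNset Fmx) (memNset Fx).
    + move=> k x; rewrite !indicE in_setI.
      by case: (x \in C); rewrite ?andbF ?andbT ?normr0// normr_nat lern1 leq_b1.
move=> mA; suff : H A by case.
apply: (lambda_system_subset GI LH GH) => //.
apply: sigma_algebra_rat_cube mA; first exact: smallest_sigma_algebra.
by move=> p; exact: sub_sigma_algebra.
Unshelve. all: by end_near. Qed.

Lemma bump_limit_sum (I : Type) (s : seq I) (F : I -> 'rV[R]_n -> R) :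
  (forall i, bump_limit (F i)) -> bump_limit (fun x => \sum_(i <- s) F i x).
Proof.
move=> bF; elim: s => [|i s IH].
  under eq_fun do rewrite big_nil; exact/bump_expr_limit/bump_expr0.
by under eq_fun do rewrite big_cons; exact: bump_limitD.
Qed.

(** The approximating simple functions are cut off to growing cubes, so that every level set is
    bounded; pointwise convergence survives and [f] itself dominates. *)
Lemma sqint_ge0_bump_limit f : sqint mu f -> (forall x, 0 <= f x) -> bump_limit f.
Proof.
move=> sf f0; have mf := sqint_measurable sf.
have mEf : measurable_fun setT (EFin \o f) by exact/measurable_EFinP.
pose s := nnsfun_approx measurableT mEf.
have s0 k x : 0 <= s k x by [].
have sle k x : s k x <= f x.
  rewrite -lee_fin /s nnsfun_approxE; apply: le_approx => // y _.
  by rewrite lee_fin.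
apply: (@bump_limit_dominated (fun k x => s k x * \1_(cube 0 k%:R) x) _ f) => //.
- move=> k; rewrite (_ : (fun _ => _) = fun x => \sum_(y <- finmap.enum_fset (fset_set (range (s k))))
      y * \1_((s k @^-1` [set y]) `&` cube 0 k%:R) x).
    apply: bump_limit_sum => y; apply: bump_limitZ; apply: bump_limit_indic.
    by rewrite -[X in measurable X]setTI; exact: measurable_funP.
  apply/funext => x; rewrite fimfunE fsbig_finite//= mulr_suml.
  by apply: eq_bigr => y _; rewrite -mulrA indicI.
- move=> x; rewrite -[X in _ --> X]mulr1; apply: cvgM.
    have Ef0 y : setT y -> (0 <= (EFin \o f) y)%E by rewrite lee_fin.
    by have /fine_cvgP[_] := cvg_nnsfun_approx measurableT mEf Ef0 (I : setT x).
  apply: cvg_near_cst; near=> k.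
  rewrite indicE mem_set// => i; rewrite mxE subr0.
  apply: le_lt_trans (rV_coord_le_norm x i) _.
  near: k; exact: nbhs_infty_gtr.
- move=> k x; rewrite ger0_norm ?mulr_ge0//.
  apply: le_trans (sle k x); by rewrite ler_piMr// indicE lern1 leq_b1.
Unshelve. all: by end_near. Qed.

Lemma sqint_bump_limit f : sqint mu f -> bump_limit f.
Proof.
move=> sf; have mf := sqint_measurable sf.
have spos : sqint mu f^\+.
  apply: sqint_le sf _; first exact: measurable_funrpos.
  by move=> x; rewrite /funrpos /Num.max; case: ifPn; rewrite ?normr0.
have sneg : sqint mu f^\-.
  apply: sqint_le sf _; first exact: measurable_funrneg.
  by move=> x; rewrite /funrneg /Num.max; case: ifPn; rewrite ?normr0// normrN.
rewrite (_ : f = fun x => f^\+ x - f^\- x); last first.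
  by apply/funext => x; rewrite -[in LHS](funrposBneg f).
by apply: bump_limitB; exact: sqint_ge0_bump_limit.
Qed.

End density.

(** * Integration by parts in H^1 *)

Section translation_sqint.
Context {R : realType} {n : nat}.
Notation mu := (lebesgue_rV R n).
Implicit Types (f g F G phi : 'rV[R]_n -> R) (v : 'rV[R]_n).

Lemma sqint_translation v f : sqint mu f -> sqint mu (fun x => f (x + v)).
Proof.
move=> /sqintP[mf intf]; apply/sqintP; split.
  exact: (measurableT_comp mf (@measurable_translation_rV _ _ v)).
exact: (@integrable_translation _ _ v (fun x => f x * f x)).
Qed.

Lemma ip_translation v f g : sqint mu f -> sqint mu g ->
  ip mu (fun x => f (x + v)) g = ip mu f (fun x => g (x - v)).
Proof.
move=> sf sg; rewrite -[RHS](@Rintegral_translation _ _ v).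
  by apply: eq_Rintegral => x _; rewrite addrK.
apply: sqint_integrable_mul => //; exact: sqint_translation.
Qed.

(** The norm is recovered by duality: testing with bumps close to [f] itself is enough. *)
Lemma nrm_le_bump f K : sqint mu f -> 0 <= K ->
  (forall phi, bump_expr phi -> `|ip mu f phi| <= K * nrm mu phi) ->
  nrm mu f <= K.
Proof.
move=> sf K0 fK; rewrite leNgt; apply/negP => Kf.
set a := nrm mu f in Kf; have a0 : 0 < a by exact: le_lt_trans Kf.
(* Small enough for [K (a + e) + a e < a^2], since [e (K + a)] is half of [a (a - K)]. *)
pose e := a * (a - K) / (2 * (K + a)).
have Ka : 0 < K + a by lra.
have e0 : 0 < e by rewrite /e divr_gt0// mulr_gt0//; lra.
have [_ /(_ _ e0)[phi bphi phie]] := sqint_bump_limit sf.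
have sphi := bump_expr_sqint bphi.
have aa : a ^+ 2 = ip mu f phi + ip mu f (fun x => f x - phi x).
  by rewrite nrm_sqr// ipBr// addrC subrK.
have h1 := le_trans (ler_norm _) (fK _ bphi).
have h2 := le_trans (ler_norm _) (cauchy_schwarz sf (sqintB sf sphi)).
have h3 : nrm mu phi <= a + e.
  apply: (@le_trans _ _ (nrm mu f + nrm mu (fun x => phi x - f x))).
    apply: le_trans (nrmD sf (sqintB sphi sf)).
    by under [in leRHS]eq_fun do rewrite addrC subrK.
  by rewrite (nrm_distC _ phi) lerD2l ltW.
have h4 : K * nrm mu phi <= K * (a + e) by rewrite ler_wpM2l.
have h5 : a * nrm mu (fun x => f x - phi x) <= a * e by rewrite ler_pM2l// ltW.
have h6 : e * (K + a) = a * (a - K) / 2.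
  by rewrite /e; field; rewrite gt_eqF.
have : a ^+ 2 <= K * (a + e) + a * e.
  by rewrite aa lerD// ?(le_trans h1)// (le_trans h2).
have : 0 < a * (a - K) by rewrite mulr_gt0// subr_gt0.
rewrite expr2; nra.
Qed.

End translation_sqint.

Section integration_by_parts.
Context {R : realType} {n : nat} (i : 'I_n).
Notation mu := (lebesgue_rV R n).
Notation e := (delta_mx ord0 i : 'rV[R]_n).
Implicit Types (f g F G phi : 'rV[R]_n -> R) (v : 'rV[R]_n) (h : R).

Lemma partial_translation phi v x :
  partial i (fun x => phi (x + v)) x = partial i phi (x + v).
Proof.
by rewrite /partial /derive; under eq_fun do rewrite /= -addrA.
Qed.

Lemma is_derive_translation phi x h : smooth_expr phi ->
  is_derive h 1 (fun h => phi (x - h *: e)) (- partial i phi (x - h *: e)).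
Proof.
move=> sphi; pose l := fun h : R => x - h *: e.
have dphi := smooth_expr_differentiable (l h) sphi.
have dl : differentiable l h.
  apply: differentiableB => //; apply: differentiableZl; exact: differentiable_id.
have dlE : 'D_1 l h = - e.
  apply: cvg_lim => //; apply: cvg_near_cst; near=> k.
  have k0 : k != 0 by near: k; exact: nbhs_dnbhs_neq.
  rewrite [X in _ *: X](_ : _ = - (k *: e)).
    by rewrite scalerN scalerA mulVf// scale1r.
  by apply/rowP => j; rewrite /l /= [_%:A]mulr1 !mxE; ring.
have dlE' : 'd l h 1 = - e by rewrite -deriveE.
have dc := differentiable_comp dl dphi.
apply: DeriveDef; first exact/derivable1_diffP.
rewrite -[LHS]/('D_1 (phi \o l) h) deriveE// diff_comp//= dlE'.
by rewrite linearN /= -deriveE.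
Unshelve. all: by end_near. Qed.

Section weak_partial_pair.
Variables (F f : 'rV[R]_n -> R).
Hypotheses (sF : sqint mu F) (sf : sqint mu f) (Ff : is_weak_partial i F f).

(** Differentiation under the integral puts the derivative on [phi], with a minus sign. The
    translate of [phi] is again a test function, and the sign in the definition of the weak
    derivative of [F] cancels the first one. *)
Lemma is_derive_ip_translation phi (a : R) : bump_expr phi ->
  is_derive a 1 (fun h => ip mu F (fun x => phi (x - h *: e)))
    (ip mu f (fun x => phi (x - a *: e))).
Proof.
move=> bphi; have [sphi [M HM]] := bphi.
have bp := bump_expr_partial i bphi; have [C C0 HC] := bump_expr_bounded bp.
have [sp [N HN]] := bp.
(* For [h] within 1 of [a], the translated partial derivative lives where all coordinates are at
   most [N + |a| + 1]; the cube is open, hence one more unit. *)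
pose B := cube (0 : 'rV[R]_n) (N + `|a| + 2).
pose k h x := F x * phi (x - h *: e).
have sB : sqint mu \1_B.
  apply: sqint_indic; [exact: measurable_cube|exact: lebesgue_cube_lty].
have dk h x : is_derive h 1 (k ^~ x) (- (F x * partial i phi (x - h *: e))).
  have [d1 d2] := is_derive_translation x h sphi.
  apply: DeriveDef; first exact: derivableM.
  rewrite (@deriveM _ _ (cst (F x)) (fun h => phi (x - h *: e)))//.
  by rewrite derive_cst d2 scaler0 addr0 /GRing.scale/= mulrN.
have E : ip mu f (fun x => phi (x - a *: e)) = \int[mu]_x (partial1of2 k a x).
  have := Ff (bump_expr_test_function (bump_expr_translation (- (a *: e)) bphi)).
  rewrite /ip => /esym/eqP; rewrite eqr_oppLR => /eqP ->.
  rewrite -[X in - X]/(ip mu F _) -ipNl//; last first.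
    by apply: bump_expr_sqint; exact/bump_expr_partial/bump_expr_translation.
  apply: eq_Rintegral => x _; rewrite partial1of2E.
  by have [_ ->] := dk a x; rewrite partial_translation mulNr.
have cv : h^-1 *: (ip mu F (fun x => phi (x - (h + a) *: e)) - ip mu F (fun x => phi (x - a *: e)))
    @[h --> 0^'] --> ip mu f (fun x => phi (x - a *: e)).
  rewrite E; apply: (@cvg_differentiation_under_integral _ _ _ mu k setT measurableT a (a - 1) (a + 1)
      _ _ _ (fun x => `|F x| * (C * \1_B x))).
  - by rewrite /= in_itv/=; apply/andP; split; lra.
  - move=> h _; apply: sqint_integrable_mul => //; apply: bump_expr_sqint.
    exact: bump_expr_translation.
  - by move=> h x _ _; have [] := dk h x.
  - by move=> x; rewrite mulr_ge0// mulr_ge0// indicE.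
  - apply: sqint_integrable_mul; last exact: sqintZ.
    apply: sqint_le sF _ => [|x]; last by rewrite normr_id.
    by apply: measurableT_comp => //; exact: sqint_measurable sF.
  - move=> h x; rewrite /= in_itv/= => /andP[h1 h2] _; rewrite partial1of2E.
    have [_ ->] := dk h x; rewrite normrN normrM ler_wpM2l//.
    have [->|px] := eqVneq (partial i phi (x - h *: e)) 0.
      by rewrite normr0 mulr_ge0// indicE.
    rewrite indicE mem_set ?mulr1// => j; rewrite mxE subr0.
    have := HN _ px j; rewrite !mxE eqxx /=.
    have : `|h| <= `|a| + 1.
      have := ler_normD a (h - a); rewrite addrC subrK => /le_trans; apply.
      by rewrite lerD2l ler_norml; apply/andP; split; lra.
    have := ler_normD (x ord0 j - h * (j == i)%:R) (h * (j == i)%:R).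
    rewrite subrK normrM.
    have : `|h| * `|(j == i)%:R| <= `|h| by rewrite ler_piMr// normr_nat lern1 leq_b1.
    lra.
have cv' : h^-1 *: (((fun h => ip mu F (fun x => phi (x - h *: e))) \o shift a) (h *: 1) -
     ip mu F (fun x => phi (x - a *: e))) @[h --> 0^'] --> ip mu f (fun x => phi (x - a *: e)).
  by under eq_fun do rewrite /= [_%:A]mulr1.
apply: DeriveDef; first by apply/cvg_ex; eexists; exact: cv'.
exact: cvg_lim cv'.
Qed.

Lemma ip_translation_lipschitz phi h : bump_expr phi ->
  `|ip mu F (fun x => phi (x - h *: e)) - ip mu F phi| <=
  `|h| * nrm mu f * nrm mu phi.
Proof.
move=> bphi; have sphi := bump_expr_sqint bphi.
pose q h := ip mu F (fun x => phi (x - h *: e)).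
pose dq h := ip mu f (fun x => phi (x - h *: e)).
have q0 : ip mu F phi = q 0.
  by congr (ip mu F _); apply/funext => x; rewrite scale0r subr0.
have dqE h' : is_derive h' 1 q (dq h') := is_derive_ip_translation h' bphi.
have dqb h' : `|dq h'| <= nrm mu f * nrm mu phi.
  apply: le_trans (cauchy_schwarz sf (sqint_translation (- (h' *: e)) sphi)) _.
  rewrite ler_wpM2l ?nrm_ge0//.
  rewrite -(@ler_pXn2r _ 2)// ?nnegrE ?nrm_ge0// !nrm_sqr//; last exact: sqint_translation.
  rewrite ip_translation//; last exact: sqint_translation.
  by under [X in ip mu phi X]eq_fun do rewrite opprK addrK.
have cq a b : {within `[a, b], continuous q}.
  apply: continuous_subspaceT => x; apply: differentiable_continuous.
  by apply/derivable1_diffP; have [] := dqE x.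
have lip a b : a <= b -> `|q b - q a| <= (b - a) * (nrm mu f * nrm mu phi).
  move=> ab; have [c _ ->] := MVT_segment ab (fun x _ => dqE x) (cq a b).
  by rewrite normrM mulrC (ger0_norm (_ : 0 <= b - a)) ?subr_ge0// ler_wpM2l ?subr_ge0.
rewrite q0 -/(q h) -mulrA; have [h0|/ltW h0] := leP 0 h.
  by have := lip _ _ h0; rewrite subr0 (ger0_norm h0).
by rewrite distrC; have := lip _ _ h0; rewrite sub0r (ler0_norm h0).
Qed.

Lemma nrm_difference h :
  nrm mu (fun x => F (x + h *: e) - F x) <= `|h| * nrm mu f.
Proof.
have sFh := sqint_translation (h *: e) sF.
apply: nrm_le_bump.
- exact: sqintB.
- by rewrite mulr_ge0// nrm_ge0.
- move=> phi bphi; have sphi := bump_expr_sqint bphi.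
  by rewrite ipBl// ip_translation//; exact: ip_translation_lipschitz.
Qed.

(** Weak convergence of the difference quotients, cleared of the division by [h]. For a bump it is
    the derivative at 0; replacing [G] by a nearby bump costs errors proportional to [|h|], by
    [nrm_difference]. *)
Lemma difference_quotient_weak G eps : sqint mu G -> 0 < eps ->
  exists2 d, 0 < d & forall h, `|h| < d ->
  `|ip mu (fun x => F (x + h *: e)) G - ip mu F G - h * ip mu f G| <= eps * `|h|.
Proof.
move=> sG eps0; have K0 := nrm_ge0 mu f.
(* Each of the two replacement errors is at most [|h| * nrm mu f] times this number, hence at most
   [eps / 3 * |h|]; the [+ 1] covers [nrm mu f = 0]. *)
have eta0 : 0 < eps / (3 * (nrm mu f + 1)) by rewrite divr_gt0// mulr_gt0// ltr_pwDr.
have [_ /(_ _ eta0)[phi bphi Gphi]] := sqint_bump_limit sG.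
have sphi := bump_expr_sqint bphi; have sGphi := sqintB sG sphi.
have [dq dqE] := is_derive_ip_translation 0 bphi.
have e30 : 0 < eps / 3 by rewrite divr_gt0.
have : h^-1 *: (((fun h => ip mu F (fun x => phi (x - h *: e))) \o shift 0) (h *: 1) -
     ip mu F (fun x => phi (x - 0 *: e))) @[h --> (0 : R)^'] -->
     'D_1 (fun h => ip mu F (fun x => phi (x - h *: e))) 0 by exact: dq.
rewrite dqE (_ : (fun x => phi (x - 0 *: e)) = phi); last first.
  by apply/funext => x; rewrite scale0r subr0.
move=> /cvgrPdist_lt/(_ _ e30)/nbhs_ballP[d d0 dP]; exists d => // h hd.
have [->|h0] := eqVneq h 0.
  rewrite normr0 mulr0 mul0r subr0 (_ : (fun x => _) = F) ?subrr ?normr0//.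
  by apply/funext => x; rewrite scale0r addr0.
have sFh := sqint_translation (h *: e) sF.
have {dP}h1 : `|ip mu (fun x => F (x + h *: e)) phi - ip mu F phi - h * ip mu f phi|
    <= eps / 3 * `|h|.
  have := dP h; rewrite /ball /= sub0r normrN => /(_ hd h0).
  rewrite addr0 [_%:A]mulr1 ip_translation// => /ltW.
  rewrite -(ler_pM2r (_ : 0 < `|h|)) ?normr_gt0//; apply: le_trans.
  rewrite -normrM distrC; set Q := _ - ip mu F phi.
  rewrite (_ : (_ - _) * h = h * ip mu f phi - Q)//.
  by rewrite /GRing.scale/=; field.
set P := fun x => F (x + h *: e); have sP : sqint mu (fun x => P x - F x) by exact: sqintB.
have h2 : `|ip mu (fun x => P x - F x) (fun x => G x - phi x)| <= eps / 3 * `|h|.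
  apply: le_trans (cauchy_schwarz sP sGphi) _.
  have h3 := nrm_difference h.
  apply: (@le_trans _ _ (`|h| * nrm mu f * (eps / (3 * (nrm mu f + 1))))).
    by apply: ler_pM; rewrite ?nrm_ge0// ltW.
  rewrite -mulrA (mulrC `|h|) ler_wpM2r//.
  rewrite mulrA ler_pdivrMr ?mulr_gt0 ?ltr_pwDr//.
  have -> : eps / 3 * (3 * (nrm mu f + 1)) = (nrm mu f + 1) * eps by field.
  by rewrite ler_wpM2r ?(ltW eps0)// lerDl.
have h3 : `|h * ip mu f (fun x => G x - phi x)| <= eps / 3 * `|h|.
  rewrite normrM mulrC ler_wpM2r//.
  apply: le_trans (cauchy_schwarz sf sGphi) _.
  apply: (@le_trans _ _ (nrm mu f * (eps / (3 * (nrm mu f + 1))))).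
    by rewrite ler_wpM2l// ltW.
  rewrite mulrA ler_pdivrMr ?mulr_gt0 ?ltr_pwDr//.
  have -> : eps / 3 * (3 * (nrm mu f + 1)) = (nrm mu f + 1) * eps by field.
  by rewrite ler_wpM2r ?(ltW eps0)// lerDl.
have -> : ip mu P G - ip mu F G - h * ip mu f G =
    (ip mu P phi - ip mu F phi - h * ip mu f phi) +
    ip mu (fun x => P x - F x) (fun x => G x - phi x) -
    h * ip mu f (fun x => G x - phi x).
  by rewrite (ipBr sG sphi sP) (ipBr sG sphi sf) !ipBl//; ring.
apply: (le_trans (ler_normB _ _)); have := ler_normD
  (ip mu P phi - ip mu F phi - h * ip mu f phi)
  (ip mu (fun x => P x - F x) (fun x => G x - phi x)).
move: h1 h2 h3; lra.
Qed.

End weak_partial_pair.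

Lemma weak_partial_ip F f G g : sqint mu F -> sqint mu f -> sqint mu G ->
  sqint mu g -> is_weak_partial i F f -> is_weak_partial i G g ->
  ip mu f G = - ip mu F g.
Proof.
move=> sF sf sG sg Ff Gg; apply/eqP; rewrite -subr_eq0 opprK -normr_le0.
rewrite leNgt; apply/negP => a0; set a := `|_| in a0.
(* Two errors of [a / 4 * h] cannot add up to [a * h]. *)
have a40 : 0 < a / 4 by rewrite divr_gt0.
have [d1 d10 H1] := difference_quotient_weak sF sf Ff sG a40.
have [d2 d20 H2] := difference_quotient_weak sG sg Gg sF a40.
pose h := Num.min d1 d2 / 2.
have m0 : 0 < Num.min d1 d2 by rewrite lt_min d10.
have h0 : 0 < h by rewrite divr_gt0.
have hm : h < Num.min d1 d2 by rewrite /h; lra.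
move: (hm); rewrite lt_min => /andP[hd1 hd2].
have := H1 h; rewrite (ger0_norm (ltW h0)) => /(_ hd1).
(* With [F] moved by [h] and [G] by [-h], translation invariance makes the leading terms equal;
   subtracting leaves [h * (ip mu f G + ip mu F g)]. *)
have := H2 (- h); rewrite normrN (ger0_norm (ltW h0)) => /(_ hd2).
rewrite (ip_translation _ sF sG) scaleNr (ipC mu _ F) (ipC mu G F) (ipC mu g F).
set u := ip mu F (fun x => _); set p := ip mu F G.
rewrite ler_norml => /andP[k1 k2]; rewrite ler_norml => /andP[l1 l2].
have : `|h * (ip mu f G + ip mu F g)| <= a / 2 * h.
  by rewrite ler_norml; apply/andP; split; lra.
rewrite normrM (ger0_norm (ltW h0)) -/a mulrC ler_pM2r//; lra.
Qed.

End integration_by_parts.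

(** * Energy estimates *)

Section weighted_data.
Context {R : realType} {n : nat}.
Notation mu := (lebesgue_rV R n).
Implicit Types (f g V : 'rV[R]_n -> R) (Omega : set 'rV[R]_n).

(** Every point outside the essential support has a neighbourhood where [f] vanishes almost
    everywhere, but there are uncountably many such points. Shrinking the neighbourhoods to rational
    cubes leaves countably many null sets, enumerated by [pickle]. *)
Lemma ess_support_ae f Omega : ess_support f `<=` Omega ->
  {ae mu, forall x, ~ Omega x -> f x = 0}.
Proof.
move=> fO.
pose Q (p : 'rV[rat]_n * nat) := {ae mu, forall y, rat_cube p y -> f y = 0}.
have : {ae mu, forall y, forall k p, unpickle k = Some p -> Q p ->
    rat_cube p y -> f y = 0}.
  apply: ae_foralln => k; case: (unpickle k) => [p|]; last exact: aeW.
  have [Qp|nQp] := pselect (Q p); last by apply: aeW => y p' [<-].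
  by apply: filterS Qp => y fy p' [<-] _; exact: fy.
apply: filterS => y fy Oy.
have [U [oU Uy Uf]] : exists U : set 'rV[R]_n,
    [/\ open U, U y & {ae mu, forall z, U z -> f z = 0}].
  apply: contrapT => nU; apply: Oy; apply: fO => U oU Uy Uf.
  by apply: nU; exists U.
have [p py pU] := open_rat_cube oU Uy.
apply: (fy (pickle p) p) => //; first exact: pickleK.
by apply: filterS Uf => z Uz /pU.
Qed.

Lemma sqint_weight V f M : continuous V -> (forall x, `|V x| <= M) ->
  sqint mu f -> sqint mu (fun x => V x * f x).
Proof.
move=> cV VM sf; apply: (sqint_le _ (sqintZ M sf)).
  apply: measurable_funM; first exact: continuous_measurable_rV.
  exact: sqint_measurable sf.
by move=> x; rewrite !normrM ler_wpM2r// (le_trans (VM x))// ler_norm.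
Qed.

(** Cauchy-Schwarz for the factorization [f phi = (f V^(-1/2)) (V^(1/2) phi)] on [Omega], where
    [V > 0]; outside, [f] vanishes almost everywhere by the support condition. *)
Lemma weighted_cauchy_schwarz V Omega f phi M : continuous V ->
  (forall x, `|V x| <= M) -> (forall x, 0 <= V x) ->
  open Omega -> (forall x, Omega x -> 0 < V x) ->
  sqint mu f -> sqint mu phi -> ess_support f `<=` Omega ->
  (weighted_sq_norm Omega V f < +oo)%E ->
  ip mu f phi ^+ 2 <=
    fine (weighted_sq_norm Omega V f) * ip mu (fun x => V x * phi x) phi.
Proof.
move=> cV VM V0 oO VO sf sphi fO Wfin.
have mV := continuous_measurable_rV cV.
have mO : measurable Omega := open_measurable_rV oO.
(* The indicator confines the negative power to [Omega], since [V] may vanish elsewhere; the square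
   of [w] then integrates to the weighted norm. *)
pose w x := f x * V x `^ (- 2^-1) * \1_Omega x.
pose z x := V x `^ 2^-1 * phi x.
have mpow r : measurable_fun setT (fun x => V x `^ r).
  exact: (measurableT_comp (measurable_powR r) mV).
have mw : measurable_fun setT w.
  apply: measurable_funM; last exact: measurable_indic.
  by apply: measurable_funM => //; exact: sqint_measurable sf.
have mz : measurable_fun setT z.
  by apply: measurable_funM => //; exact: sqint_measurable sphi.
have WE : (weighted_sq_norm Omega V f = \int[mu]_x (w x * w x)%:E)%E.
  rewrite /weighted_sq_norm integral_mkcond; apply: eq_integral => x _.
  rewrite patchE /w indicE; case: (boolP (x \in Omega)) => [|_] /=; last first.
    by rewrite !mulr0.
  rewrite inE => /VO Vx; rewrite !mulr1 mulrACA -powRD ?(gt_eqF Vx) ?implybT//.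
  rewrite (_ : - 2^-1 + - 2^-1 = -1); last by field.
  rewrite powR_inv1; last exact: ltW.
  by rewrite real_normK ?num_real// expr2.
have sw : sqint mu w.
  apply/sqintP; split=> //; apply/integrableP; split.
    by apply/measurable_EFinP; exact: measurable_funM.
  rewrite WE in Wfin; apply: le_lt_trans Wfin.
  by under eq_integral do rewrite gee0_abs ?lee_fin -?expr2 ?sqr_ge0//.
have zzE x : z x * z x = V x * phi x * phi x.
  rewrite /z mulrACA -powRD (_ : 2^-1 + 2^-1 = 1); [|by field|by rewrite oner_eq0|by field].
  by rewrite powRr1// mulrA.
have sVp := sqint_weight cV VM sphi.
have sz : sqint mu z.
  apply/sqintP; split=> //; under eq_fun do rewrite zzE.
  exact: sqint_integrable_mul.
have -> : ip mu f phi = ip mu w z.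
  rewrite /ip /Rintegral; congr fine; apply: ae_eq_integral => //.
  - apply/measurable_EFinP; apply: measurable_funM.
      exact: sqint_measurable sf.
    exact: sqint_measurable sphi.
  - by apply/measurable_EFinP; exact: measurable_funM.
  - apply: filterS (ess_support_ae fO) => x fx _.
    rewrite /w /z indicE; case: (boolP (x \in Omega)) => [|]; last first.
      by rewrite notin_setE => /fx ->; rewrite !mul0r.
    rewrite inE => /VO Vx; rewrite mulr1 mulrA -(mulrA (f x)) -powRD.
      by rewrite addNr powRr0 mulr1.
    by rewrite (gt_eqF Vx) implybT.
have -> : fine (weighted_sq_norm Omega V f) = nrm mu w ^+ 2.
  by rewrite nrm_sqr// WE.
have -> : ip mu (fun x => V x * phi x) phi = nrm mu z ^+ 2.
  by rewrite nrm_sqr//; apply: eq_Rintegral => x _; rewrite zzE.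
rewrite -exprMn -[leLHS]real_normK ?num_real// ler_pXn2r ?nnegrE ?mulr_ge0 ?nrm_ge0//.
exact: cauchy_schwarz.
Qed.

End weighted_data.

(** * Symmetry and sign of the weak Laplacian *)

Section elliptic.
Context {R : realType} {n : nat}.
Notation mu := (lebesgue_rV R n).
Implicit Types (f g u v : 'rV[R]_n -> R).

Lemma weak_partialP i f : has_weak_partial i f ->
  sqint mu (weak_partial i f) /\ is_weak_partial i f (weak_partial i f).
Proof.
move=> [g sg fg].
exact: (xgetPex (cst 0) (ex_intro (fun g => L2 g /\ is_weak_partial i f g) g (conj sg fg))).
Qed.

Lemma H2_sqint u : H2 u -> sqint mu u.
Proof. by case=> -[]. Qed.

Lemma sqint_sum (I : Type) (s : seq I) (F : I -> 'rV[R]_n -> R) :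
  (forall i, sqint mu (F i)) -> sqint mu (fun x => \sum_(i <- s) F i x).
Proof.
move=> sF; elim: s => [|i s IH].
  by under eq_fun do rewrite big_nil; exact: sqint0.
by under eq_fun do rewrite big_cons; exact: sqintD.
Qed.

Lemma ip_suml (I : Type) (s : seq I) (F : I -> 'rV[R]_n -> R) g :
  (forall i, sqint mu (F i)) -> sqint mu g ->
  ip mu (fun x => \sum_(i <- s) F i x) g = \sum_(i <- s) ip mu (F i) g.
Proof.
move=> sF sg; elim: s => [|i s IH].
  under eq_fun do rewrite big_nil; rewrite big_nil /ip.
  under eq_Rintegral do rewrite mul0r.
  by rewrite Rintegral_cst// mul0r.
under eq_fun do rewrite big_cons; rewrite big_cons ipDl ?IH//.
exact: sqint_sum.
Qed.

Lemma sqint_weak_laplacian u : H2 u -> sqint mu (weak_laplacian u).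
Proof.
move=> [_ H]; apply: sqint_sum => i.
by have [_ /(_ i)/weak_partialP[]] := H i.
Qed.

(** Green's formula: in each direction the second derivative of [u] is a weak derivative of
    [weak_partial i u], and it is moved onto [v]. *)
Lemma ip_weak_laplacian u v : H2 u -> H2 v -> ip mu (weak_laplacian u) v =
  - \sum_(i < n) ip mu (weak_partial i u) (weak_partial i v).
Proof.
move=> [[su Hu] HHu] [[sv Hv] _]; rewrite ip_suml//; last first.
  by move=> i; have [_ /(_ i)/weak_partialP[]] := HHu i.
rewrite -sumrN; apply: eq_bigr => i _.
have [su' wu] := weak_partialP (Hu i); have [sv' wv] := weak_partialP (Hv i).
have [_ /(_ i)/weak_partialP[su'' wu']] := HHu i.
exact: weak_partial_ip wu' wv.
Qed.

Lemma ip_gradientC u v :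
  \sum_(i < n) ip mu (weak_partial i u) (weak_partial i v) =
  \sum_(i < n) ip mu (weak_partial i v) (weak_partial i u).
Proof. by apply: eq_bigr => i _; exact: ipC. Qed.

Lemma ip_weak_laplacianC u v : H2 u -> H2 v ->
  ip mu (weak_laplacian u) v = ip mu u (weak_laplacian v).
Proof.
move=> Hu Hv; rewrite (ip_weak_laplacian Hu Hv) [RHS]ipC (ip_weak_laplacian Hv Hu).
exact: (congr1 -%R (ip_gradientC u v)).
Qed.

Lemma ip_weak_laplacian_le0 u : H2 u -> ip mu (weak_laplacian u) u <= 0.
Proof.
move=> Hu; rewrite (ip_weak_laplacian Hu Hu) oppr_le0.
by apply: sumr_ge0 => i _; exact: ip_ge0.
Qed.

End elliptic.

(** * Product rule for curves in L^2 *)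

Section L2_curves.
Context d (T : measurableType d) (R : realType) (mu : {measure set T -> \bar R}).
Implicit Types (a b : R -> T -> R).

(** Leibniz rule for strong L^2 derivatives. Membership in L^2 is asked near [s] only, because a
    solution is known to be in L^2 only at nonnegative times. *)
Lemma is_derive_ip a b (s : R) da db :
  (\forall t \near s, sqint mu (a t)) -> (\forall t \near s, sqint mu (b t)) ->
  sqint mu da -> sqint mu db ->
  nrm mu (fun x => h^-1 * (a (s + h) x - a s x) - da x) @[h --> 0^'] --> (0 : R) ->
  nrm mu (fun x => h^-1 * (b (s + h) x - b s x) - db x) @[h --> 0^'] --> (0 : R) ->
  is_derive s 1 (fun t => ip mu (a t) (b t)) (ip mu da (b s) + ip mu (a s) db).
Proof.
move=> na nb sda sdb ca cb.
have shiftP (P : set R) : (\forall t \near s, P t) -> \forall h \near 0^', P (s + h).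
  move=> /nbhs_ballP[r r0 rP]; apply/nbhs_dnbhs/nbhs_ballP; exists r => // k.
  rewrite /ball /= sub0r normrN => kr; apply: rP.
  by rewrite /ball /= opprD addrA subrr sub0r normrN.
have sa := nbhs_singleton na; have sb := nbhs_singleton nb.
pose al h := nrm mu (fun x => h^-1 * (a (s + h) x - a s x) - da x).
pose be h := nrm mu (fun x => h^-1 * (b (s + h) x - b s x) - db x).
have {}ca : al h @[h --> 0^'] --> (0 : R) := ca.
have {}cb : be h @[h --> 0^'] --> (0 : R) := cb.
(* Majorant of the error of the difference quotient. The factor [|h| * (be h + nrm mu db)] bounds
   the norm of [b (s + h) - b s]: continuity of [b] comes from its differentiability. *)
pose bd h := al h * (nrm mu (b s) + `|h| * (be h + nrm mu db)) +
  nrm mu da * (`|h| * (be h + nrm mu db)) + nrm mu (a s) * be h.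
have bd0 : bd h @[h --> 0^'] --> (0 : R).
  have ch : `|h| @[h --> (0:R)^'] --> (0 : R).
    rewrite -[X in _ --> X](@normr0 _ R); apply: cvg_norm.
    exact: nbhs_dnbhs.
  have c1 : `|h| * (be h + nrm mu db) @[h --> (0:R)^'] --> (0 : R).
    rewrite -[X in _ --> X](mul0r (0 + nrm mu db)).
    by apply: cvgM; [exact: ch|apply: cvgD; [exact: cb|exact: cvg_cst]].
  rewrite [X in _ --> X](_ : 0 = 0 * (nrm mu (b s) + 0) + nrm mu da * 0 + nrm mu (a s) * 0); last by ring.
  apply: cvgD; last by apply: cvgM; [exact: cvg_cst|exact: cb].
  apply: cvgD; last by apply: cvgM; [exact: cvg_cst|exact: c1].
  by apply: cvgM; [exact: ca|apply: cvgD; [exact: cvg_cst|exact: c1]].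
have cv : h^-1 *: (((fun t => ip mu (a t) (b t)) \o shift s) (h *: 1) - ip mu (a s) (b s))
    @[h --> 0^'] --> ip mu da (b s) + ip mu (a s) db.
  apply/cvgrPdist_lt => e e0; near=> h.
  have h0 : h != 0 by near: h; exact: nbhs_dnbhs_neq.
  have sah : sqint mu (a (s + h)).
    by near: h; exact: shiftP na.
  have sbh : sqint mu (b (s + h)).
    by near: h; exact: shiftP nb.
  have bde : `|bd h| < e by near: h; exact: (cvgr0_norm_lt _ bd0).
  apply: le_lt_trans (le_lt_trans (ler_norm _) bde).
  rewrite /= [_%:A]mulr1 (addrC h s) distrC.
  pose A x := h^-1 * (a (s + h) x - a s x); pose B x := h^-1 * (b (s + h) x - b s x).
  have sA : sqint mu A by apply: sqintZ; exact: sqintB.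
  have sB : sqint mu B by apply: sqintZ; exact: sqintB.
  have sAd := sqintB sA sda; have sBd := sqintB sB sdb.
  have sbb := sqintB sbh sb.
  have -> : h^-1 *: (ip mu (a (s + h)) (b (s + h)) - ip mu (a s) (b s)) -
      (ip mu da (b s) + ip mu (a s) db) =
    ip mu (fun x => A x - da x) (b (s + h)) +
    ip mu da (fun x => b (s + h) x - b s x) + ip mu (a s) (fun x => B x - db x).
    rewrite (ipBl sA sda sbh) (ipBr sbh sb sda) (ipBr sB sdb sa).
    rewrite /A /B ipZl ?ipZr//; try exact: sqintB.
    by rewrite (ipBl sah sa sbh) (ipBr sbh sb sa) /GRing.scale/=; ring.
  have nbb : nrm mu (fun x => b (s + h) x - b s x) <= `|h| * (be h + nrm mu db).
    rewrite (_ : (fun x => _) = fun x => h * ((B x - db x) + db x)).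
      by rewrite nrmZ ?ler_wpM2l ?nrmD//; exact: sqintD.
    by apply/funext => x; rewrite subrK /B mulrA mulfV// mul1r.
  have nbh : nrm mu (b (s + h)) <= nrm mu (b s) + `|h| * (be h + nrm mu db).
    apply: le_trans (lerD (lexx _) nbb); apply: le_trans (nrmD sb sbb).
    by under [in leRHS]eq_fun do rewrite addrC subrK.
  apply: le_trans (ler_normD _ _) (lerD _ _); last exact: cauchy_schwarz.
  apply: le_trans (ler_normD _ _) (lerD _ _).
    apply: le_trans (cauchy_schwarz sAd sbh) _.
    by rewrite ler_wpM2l ?nrm_ge0.
  apply: le_trans (cauchy_schwarz sda sbb) _.
  by rewrite ler_wpM2l ?nrm_ge0.
by apply: DeriveDef; [apply/cvg_ex; eexists; exact: cv|exact: cvg_lim cv].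
Unshelve. all: by end_near. Qed.

End L2_curves.

(** * A Riccati differential inequality *)

Section riccati.
Context {R : realType}.

(** Where [f > 0], the inequality says that [W / f] has derivative at least 2. Integrating over
    [[s, t]] gives [2 (t - s) <= W / f t] for every small [s > 0]; nothing is assumed at 0, so the
    integration cannot start there. *)
Lemma riccati_decay (f df : R -> R) (W : R) : 0 <= W ->
  (forall t : R, 0 < t -> is_derive t 1 f (df t)) ->
  (forall t, 0 < t -> 0 <= f t) ->
  (forall t, 0 < t -> 2 * f t ^+ 2 <= - (W * df t)) ->
  forall t, 0 < t -> 2 * t * f t <= W.
Proof.
move=> W0 fdf f0 fW t t0.
have cf a b : 0 < a -> {within `[a, b], continuous f}.
  move=> a0; apply: derivable_within_continuous => x; rewrite in_itv/= => /andP[ax _].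
  by have [] := fdf x (lt_le_trans a0 ax).
have df0 s : 0 < s -> W = 0 \/ df s <= 0.
  move=> s0; have [->|Wn0] := eqVneq W 0; [by left|right].
  have := fW _ s0; have Wp : 0 < W by rewrite lt_def Wn0.
  have := sqr_ge0 (f s) => h1 h2; rewrite -(pmulr_rle0 _ Wp); lra.
(* With [W = 0] the inequality forces [f t = 0]. *)
have [W00|Wn0] := eqVneq W 0.
  have := fW _ t0; rewrite W00 mul0r oppr0 => h.
  have /eqP : f t ^+ 2 = 0 by apply/eqP; rewrite eq_le sqr_ge0 andbT; lra.
  by rewrite sqrf_eq0 => /eqP ->; rewrite mulr0.
have {}df0 s : 0 < s -> df s <= 0 by move=> /df0[W00|//]; rewrite W00 eqxx in Wn0.
have fmono s : 0 < s -> s <= t -> f t <= f s.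
  move=> s0 st; have fdf' x : x \in `]s, t[ -> is_derive x 1 f (df x).
    by rewrite in_itv/= => /andP[sx _]; apply: fdf; exact: lt_trans sx.
  have [c + E] := MVT_segment st fdf' (cf s t s0).
  rewrite in_itv/= => /andP[sc _]; rewrite -subr_le0 E.
  by rewrite mulr_le0_ge0 ?subr_ge0// df0// (lt_le_trans s0).
(* If [f t] is positive, monotonicity keeps [f] positive on all of (0, t], so that its inverse can
   be differentiated there. *)
have [ft0|ft0] := leP (f t) 0.
  by apply: le_trans W0; rewrite mulr_ge0_le0// mulr_ge0// ltW.
pose g s := (f s)^-1.
have fpos s : 0 < s -> s <= t -> 0 < f s by move=> s0 st; exact: lt_le_trans (fmono s s0 st).
have dg s : 0 < s -> s <= t -> is_derive s 1 g (- f s ^- 2 * df s).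
  move=> s0 st; have := @is_deriveV _ f s _ 1 (lt0r_neq0 (fpos s s0 st)) (fdf s s0).
  by [].
have step s : 0 < s -> s < t -> 2 * (t - s) * f t <= W.
  move=> s0 st; have dg' x : x \in `]s, t[ -> is_derive x 1 g (- f x ^- 2 * df x).
    rewrite in_itv/= => /andP[sx xt]; apply: dg; last exact: ltW.
    exact: lt_trans sx.
  have cg : {within `[s, t], continuous g}.
    apply: derivable_within_continuous => x; rewrite in_itv/= => /andP[sx xt].
    by have [] := dg x (lt_le_trans s0 sx) xt.
  have [c + E] := MVT_segment (ltW st) dg' cg.
  rewrite in_itv/= => /andP[sc ct]; have c0 := lt_le_trans s0 sc.
  have fc := fpos c c0 ct; have fs := fpos s s0 (ltW st).
  have h1 : 2 <= W * (- f c ^- 2 * df c).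
    rewrite mulNr mulrN mulrCA -mulrN ler_pdivlMl ?exprn_gt0// mulrC; exact: fW.
  have h2 : 2 * (t - s) <= W * g t - W * g s.
    by rewrite -mulrBr E mulrA ler_wpM2r// subr_ge0 ltW.
  have h3 : 0 <= W * g s by rewrite mulr_ge0// invr_ge0 ltW.
  have : 2 * (t - s) <= W * g t by lra.
  by rewrite /g ler_pdivlMr.
rewrite leNgt; apply/negP => Wt.
(* Chosen so that [2 s f t] is half of the excess [2 t f t - W]; then [2 (t - s) f t] still exceeds
   [W]. *)
pose s := t * (2 * t * f t - W) / (2 * (2 * t * f t)).
have tf0 : 0 < t * f t by exact: mulr_gt0.
have s0 : 0 < s by rewrite /s divr_gt0 ?mulr_gt0 ?subr_gt0//.
have sE : 2 * s * f t = (2 * t * f t - W) / 2.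
  by rewrite /s; field; rewrite !gt_eqF.
have st : s < t.
  by rewrite -(ltr_pM2r ft0); nra.
by have := step s s0 st; nra.
Qed.

End riccati.

(** * The heat equation with potential *)

Section heat.
Context {R : realType} {n : nat}.
Notation mu := (lebesgue_rV R n).
Variables (V : 'rV[R]_n -> R) (M : R).
Hypotheses (cV : continuous V) (VM : forall x, `|V x| <= M)
  (V0 : forall x, 0 <= V x).

Definition schroedinger (v : 'rV[R]_n -> R) : 'rV[R]_n -> R :=
  fun x => V x * v x - weak_laplacian v x.

Lemma sqint_schroedinger v : H2 v -> sqint mu (schroedinger v).
Proof.
move=> Hv; apply: sqintB; last exact: sqint_weak_laplacian.
by apply: (sqint_weight cV VM); exact: H2_sqint.
Qed.

Lemma ip_schroedinger v g : H2 v -> sqint mu g ->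
  ip mu (schroedinger v) g =
  ip mu (fun x => V x * v x) g - ip mu (weak_laplacian v) g.
Proof.
move=> Hv sg; apply: ipBl => //; last exact: sqint_weak_laplacian.
by apply: (sqint_weight cV VM); exact: H2_sqint.
Qed.

Lemma ip_weightC v w :
  ip mu (fun x => V x * v x) w = ip mu (fun x => V x * w x) v.
Proof. by apply: eq_Rintegral => x _; rewrite mulrAC. Qed.

Lemma ip_schroedingerC v w : H2 v -> H2 w ->
  ip mu (schroedinger v) w = ip mu v (schroedinger w).
Proof.
move=> Hv Hw; rewrite [RHS]ipC [LHS](ip_schroedinger Hv (H2_sqint Hw)).
rewrite [RHS](ip_schroedinger Hw (H2_sqint Hv)).
have laplC := etrans (ip_weak_laplacianC Hv Hw) (ipC mu v (weak_laplacian w)).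
exact (congr2 (fun a b => a - b) (ip_weightC v w) laplC).
Qed.

Lemma ip_schroedinger_ge v : H2 v ->
  ip mu (fun x => V x * v x) v <= ip mu (schroedinger v) v.
Proof.
move=> Hv; rewrite (ip_schroedinger Hv (H2_sqint Hv)).
by have := ip_weak_laplacian_le0 Hv; lra.
Qed.

Lemma ip_weight_ge0 v : 0 <= ip mu (fun x => V x * v x) v.
Proof.
by apply: Rintegral_ge0 => x _; rewrite -mulrA -expr2 mulr_ge0// sqr_ge0.
Qed.

(** * Evolution of the energy along a solution *)

Section solution.
Implicit Types s t : R.
Variables u0 : 'rV[R]_n -> R.
Variables u ut : R -> 'rV[R]_n -> R.
Hypothesis su0 : sqint mu u0.
Hypothesis cu : continuous_L2 [set t | 0 <= t] u.
Hypothesis Hu : forall t, 0 < t -> H2 (u t).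
Hypothesis u0E : {ae mu, forall x, u 0 x = u0 x}.
Hypothesis sut : forall t, 0 < t -> sqint mu (ut t).
Hypothesis dut : forall t, 0 < t -> is_L2_derivative u t (ut t).
Hypothesis utE : forall t, 0 < t ->
  {ae mu, forall x, ut t x - weak_laplacian (u t) x + V x * u t x = 0}.

Let su t : 0 <= t -> sqint mu (u t).
Proof. by move=> t0; exact: cu.1. Qed.

(** The equation holds only almost everywhere, so it is used in this tested form. *)
Lemma ip_ut t g : 0 < t -> sqint mu g ->
  ip mu (ut t) g = - ip mu (schroedinger (u t)) g.
Proof.
move=> t0 sg; have sS := sqint_schroedinger (Hu t0).
rewrite -ipNl//; apply: ip_ae.
- exact: sqint_measurable (sut t0).
- exact: sqint_measurable (sqintN sS).
- exact: sqint_measurable sg.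
- apply: filterS (utE t0) => x /eqP; rewrite /schroedinger; move=> /eqP; lra.
Qed.

Let su_near t : 0 < t -> \forall s \near t, sqint mu (u s).
Proof.
by move=> t0; near=> s; apply: su; apply: ltW; near: s; exact: lt_nbhsr.
Unshelve. all: by end_near. Qed.

Definition energy (t : R) : R := ip mu (u t) (u t).

Lemma is_derive_energy t : 0 < t ->
  is_derive t 1 energy (- (2 * ip mu (schroedinger (u t)) (u t))).
Proof.
move=> t0; have sut0 := su (ltW t0).
have [D1 D2] := is_derive_ip (su_near t0) (su_near t0) (sut t0) (sut t0) (dut t0) (dut t0).
apply: DeriveDef; first exact: D1.
etransitivity; first exact: D2.
rewrite (ipC mu (u t)) (ip_ut t0 sut0).
by rewrite mulrDl mul1r opprD.
Qed.

(* [schroedinger] is symmetric, so the two terms of the derivative cancel. *)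
Lemma is_derive_crossed s t : 0 < s -> s < t ->
  is_derive s 1 (fun r => ip mu (u r) (u (t - r))) 0.
Proof.
move=> s0 st; have ts0 : 0 < t - s by rewrite subr_gt0.
have nb : \forall r \near s, sqint mu (u (t - r)).
  by near=> r; apply: su; rewrite subr_ge0 ltW//; near: r; exact: lt_nbhsl.
have db : nrm mu (fun x => h^-1 * (u (t - (s + h)) x - u (t - s) x) - (- ut (t - s) x))
    @[h --> 0^'] --> (0 : R).
  apply/cvgr0Pnorm_lt => e e0.
  have /cvgr0Pnorm_lt/(_ e e0)/nbhs_ballP[d d0 dP] := dut ts0.
  apply/nbhs_ballP; exists d => // h hd h0.
  (* The error of the quotient of the time-reversed curve at [h] is the opposite of the error for
     [u] at [-h], so the norms agree. *)
  have := dP (- h); rewrite /ball /= sub0r opprK oppr_eq0 => /(_ _ h0).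
  rewrite (_ : `|h| < d); last by move: hd; rewrite /ball /= sub0r normrN.
  move=> /(_ isT); rewrite -[L2norm _]/(nrm mu _) -nrmN.
  rewrite (_ : (fun x => - _) = fun x =>
    h^-1 * (u (t - (s + h)) x - u (t - s) x) - (- ut (t - s) x))//.
  by apply/funext => x; rewrite (_ : t - (s + h) = t - s - h); [rewrite invrN|]; ring.
have sdb := sqintN (sut ts0).
have [D1 D2] := is_derive_ip (su_near s0) nb (sut s0) sdb (dut s0) db.
apply: DeriveDef; first exact: D1.
etransitivity; first exact: D2.
rewrite (ip_ut s0 (su (ltW ts0))).
rewrite (ipC mu (u s)) (ipNl (sut ts0) (su (ltW s0))) (ip_ut ts0 (su (ltW s0))) opprK.
have symS := etrans (ip_schroedingerC (Hu s0) (Hu ts0)) (ipC mu (u s) _).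
by apply/eqP; rewrite addrC subr_eq0; apply/eqP; exact: esym symS.
Unshelve. all: by end_near. Qed.

Let u_near0 e : 0 < e -> exists2 d, 0 < d & forall s, 0 <= s -> s < d ->
  nrm mu (fun x => u s x - u 0 x) < e.
Proof.
move=> e0; have /cvgr0Pnorm_lt/(_ e e0)/nbhs_ballP[d d0 dP] := cu.2 0 (lexx _).
exists d => // s s0 sd; have := dP s; rewrite /ball /= sub0r normrN (ger0_norm s0).
by move=> /(_ sd s0); rewrite ger0_norm ?nrm_ge0.
Qed.

Let u_near t e : 0 < t -> 0 < e -> exists2 d, 0 < d & forall s, 0 <= s -> s < d ->
  s <= t -> nrm mu (fun x => u (t - s) x - u t x) < e.
Proof.
move=> t0 e0; have /cvgr0Pnorm_lt/(_ e e0)/nbhs_ballP[d d0 dP] := cu.2 t (ltW t0).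
exists d => // s s0 sd st; have := dP (t - s); rewrite /ball /= opprB addrC subrK.
by rewrite (ger0_norm s0) subr_ge0 => /(_ sd st); rewrite ger0_norm ?nrm_ge0.
Qed.

(** The derivative of the crossed product is available only inside (0, t), as [u 0] need not be in
    H^2. The value at [t / 2] is therefore compared with that at a small [s], and the L^2 continuity
    of [u] at 0 and at [t] lets [s] tend to 0. *)
Lemma ip_initial t : 0 < t -> ip mu u0 (u t) = energy (t / 2).
Proof.
move=> t0; have t20 : 0 < t / 2 by rewrite divr_gt0.
have u00 : sqint mu (u 0) by exact: su.
have sut0 := su (ltW t0).
rewrite -(@ip_ae _ _ _ mu (u 0)) //; first last.
  exact: sqint_measurable sut0.
  exact: sqint_measurable su0.
  exact: sqint_measurable u00.
pose k r := ip mu (u r) (u (t - r)).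
have kE s : 0 < s -> s <= t / 2 -> k s = energy (t / 2).
  move=> s0 st.
  have dk x : x \in `]s, (t / 2)[ -> is_derive x 1 k (cst 0 x).
    rewrite in_itv/= => /andP[sx xt]; apply: is_derive_crossed; first exact: lt_trans sx.
    by apply: lt_trans xt _; lra.
  have ck : {within `[s, t / 2], continuous k}.
    apply: derivable_within_continuous => x; rewrite in_itv/= => /andP[sx xt].
    have xt' : x < t by lra.
    by have [] := is_derive_crossed (lt_le_trans s0 sx) xt'.
  have [c _] := MVT_segment st dk ck.
  rewrite mul0r => /eqP; rewrite subr_eq0 => /eqP <-.
  by rewrite /k /energy (_ : t - t / 2 = t / 2)//; field.
apply/eqP; rewrite -subr_eq0 -normr_le0 leNgt; apply/negP => a0.
set a := `|_| in a0.
(* Adds the norms that multiply the two increments, [nrm mu (u (t - s))] being at most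
   [nrm mu (u t) + 1]; increments below [a / (2 * K)] then produce an error of at most [a / 2]. *)
pose K := nrm mu (u t) + 1 + nrm mu (u 0).
have K0 : 0 < K by rewrite /K; have := nrm_ge0 mu (u t); have := nrm_ge0 mu (u 0); lra.
have e0 : 0 < a / (2 * K) by rewrite divr_gt0// mulr_gt0.
have [d1 d10 H1] := u_near0 e0.
have e10 : 0 < Num.min 1 (a / (2 * K)) by rewrite lt_min ltr01.
have [d2 d20 H2] := u_near t0 e10.
pose m := Num.min (t / 2) (Num.min d1 d2); pose s := m / 2.
have m0 : 0 < m by rewrite !lt_min t20 d10.
have s0 : 0 < s by rewrite divr_gt0.
have : s < m by rewrite /s; lra.
rewrite !lt_min => /and3P[st sd1 sd2].
have {H1} := H1 s (ltW s0) sd1; have := H2 s (ltW s0) sd2 _; have st' : s <= t by lra.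
move=> /(_ st'); rewrite lt_min => /andP[h1 h2] h3.
have sts : sqint mu (u (t - s)) by apply: su; rewrite subr_ge0.
have sus : sqint mu (u s) by exact/su/ltW.
have h4 : nrm mu (u (t - s)) <= nrm mu (u t) + 1.
  apply: (@le_trans _ _ (nrm mu (u t) + nrm mu (fun x => u (t - s) x - u t x))).
    apply: le_trans (nrmD sut0 (sqintB sts sut0)).
    by under [in leRHS]eq_fun do rewrite addrC subrK.
  by rewrite lerD2l ltW.
have aE : a = `|ip mu (fun x => u s x - u 0 x) (u (t - s)) +
   ip mu (u 0) (fun x => u (t - s) x - u t x)|.
  rewrite /a -(kE s s0 (ltW st)) distrC /k (ipBl sus u00 sts) (ipBr sts sut0 u00).
  by congr (`| _ |); ring.
have h5 := cauchy_schwarz (sqintB sus u00) sts.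
have h6 := cauchy_schwarz u00 (sqintB sts sut0).
have h7 := ler_normD (ip mu (fun x => u s x - u 0 x) (u (t - s)))
   (ip mu (u 0) (fun x => u (t - s) x - u t x)).
rewrite -aE in h7.
have h8 : nrm mu (fun x => u s x - u 0 x) * nrm mu (u (t - s)) <=
    a / (2 * K) * (nrm mu (u t) + 1).
  by apply: ler_pM; rewrite ?nrm_ge0// ltW.
have h9 : nrm mu (u 0) * nrm mu (fun x => u (t - s) x - u t x) <=
    nrm mu (u 0) * (a / (2 * K)).
  by rewrite ler_wpM2l ?nrm_ge0// ltW.
have h10 : a / (2 * K) * (nrm mu (u t) + 1) + nrm mu (u 0) * (a / (2 * K)) = a / 2.
  by rewrite (mulrC (nrm mu (u 0))) -mulrDr -/K; field; rewrite gt_eqF.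
lra.
Qed.

Lemma energy_nonincreasing s t : 0 < s -> s <= t -> energy t <= energy s.
Proof.
move=> s0 st; pose df t := - (2 * ip mu (schroedinger (u t)) (u t)).
have de x : x \in `]s, t[ -> is_derive x 1 energy (df x).
  by rewrite in_itv/= => /andP[sx _]; apply: is_derive_energy; exact: lt_trans sx.
have ce : {within `[s, t], continuous energy}.
  apply: derivable_within_continuous => x; rewrite in_itv/= => /andP[sx _].
  by have [] := is_derive_energy (lt_le_trans s0 sx).
have [c + E] := MVT_segment st de ce.
rewrite in_itv/= => /andP[sc _]; rewrite -subr_le0 E mulr_le0_ge0 ?subr_ge0//.
have Hc := Hu (lt_le_trans s0 sc).
rewrite oppr_le0 mulr_ge0// (le_trans (ip_weight_ge0 (u c)))//.
exact: ip_schroedinger_ge.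
Qed.

Lemma energy0 : energy 0 = nrm mu u0 ^+ 2.
Proof.
have m0 := sqint_measurable su0; have mu0 := sqint_measurable (su (lexx 0)).
rewrite nrm_sqr// /energy (ip_ae mu0 m0 mu0 u0E) ipC.
exact: ip_ae.
Qed.

(** Monotonicity is known at positive times only; a small [s] and the L^2 continuity at 0 bring in
    the initial norm, up to an arbitrary [e]. *)
Lemma energy_le_initial t : 0 <= t -> energy t <= nrm mu u0 ^+ 2.
Proof.
rewrite le_eqVlt => /predU1P[<-|t0]; first by rewrite energy0.
have u00 : sqint mu (u 0) by exact: su.
rewrite -energy0 /energy -!nrm_sqr//; last exact/su/ltW.
rewrite ler_pXn2r ?nnegrE ?nrm_ge0//; apply/ler_addgt0Pr => e e0.
have [d d0 dP] := u_near0 e0.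
pose s := Num.min d t / 2.
have m0 : 0 < Num.min d t by rewrite lt_min d0.
have s0 : 0 < s by rewrite divr_gt0.
have : s < Num.min d t by rewrite /s; lra.
rewrite lt_min => /andP[sd st]; have sus := su (ltW s0).
apply: (@le_trans _ _ (nrm mu (u s))).
  rewrite -(@ler_pXn2r _ 2)// ?nnegrE ?nrm_ge0// !nrm_sqr//; last exact/su/ltW.
  exact: energy_nonincreasing s0 (ltW st).
apply: (@le_trans _ _ (nrm mu (u 0) + nrm mu (fun x => u s x - u 0 x))).
  apply: le_trans (nrmD u00 (sqintB sus u00)).
  by under [in leRHS]eq_fun do rewrite addrC subrK.
by rewrite lerD2l ltW// dP// ltW.
Qed.

Lemma energy_decay Omega t : open Omega -> (forall x, Omega x -> 0 < V x) ->
  ess_support u0 `<=` Omega -> (weighted_sq_norm Omega V u0 < +oo)%E ->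
  0 < t -> 2 * t * energy t <= fine (weighted_sq_norm Omega V u0).
Proof.
move=> oO VO u0O Wfin; set W := fine _.
have W0 : 0 <= W.
  apply/fine_ge0/integral_ge0 => x Ox; rewrite lee_fin.
  by rewrite divr_ge0 ?sqr_ge0.
apply: (riccati_decay W0 is_derive_energy) => [s _|s s0]; first exact: ip_ge0.
have sus := su (ltW s0).
(* The 2 in the derivative of the energy cancels the 2 of the Riccati inequality; what remains is
   [energy s ^+ 2 <= W * ip mu (schroedinger (u s)) (u s)]. *)
rewrite /= mulrN opprK (mulrCA (fine _)) ler_pM2l//.
apply: (@le_trans _ _ (ip mu u0 (u s) ^+ 2)).
  rewrite ip_initial// ler_pXn2r ?nnegrE ?ip_ge0//.
  by apply: energy_nonincreasing; [rewrite divr_gt0|lra].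
apply: le_trans (weighted_cauchy_schwarz cV VM V0 oO VO su0 sus u0O Wfin) _.
by rewrite ler_wpM2l//; exact/ip_schroedinger_ge/Hu.
Qed.

End solution.

End heat.

Unset Implicit Arguments.

Theorem theorem1p6 (R : realType) (n : nat) (Omega : set 'rV[R]_n)
    (V : 'rV[R]_n -> R) :
  (1 <= n)%N ->
  open Omega ->
  (exists M : R, forall x, `|V x| <= M) ->
  continuous V ->
  (forall x, Omega x -> 0 < V x) ->
  (forall x, 0 <= V x) ->
  exists2 C : R, 0 < C &
    forall (u0 : 'rV[R]_n -> R) (u : R -> 'rV[R]_n -> R),
      L2 u0 ->
      ess_support u0 `<=` Omega ->
      (weighted_sq_norm Omega V u0 < +oo)%E ->
      heat_solution V u0 u ->
      forall t : R, 0 <= t ->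
        (1 + t) * L2norm (u t) ^+ 2 <=
        C * (L2norm u0 ^+ 2 + fine (weighted_sq_norm Omega V u0)).
Proof.
move=> _ oO [M VM] cV VO V0; exists 1 => // u0 u su0 u0O Wfin.
move=> [cu cH u0E [ut [[sut _] dut utE]]] t t0.
have Hu s : 0 < s -> H2 (u s) by move=> s0; exact: cH.1.
rewrite -[L2norm (u t)]/(nrm (lebesgue_rV R n) (u t)) nrm_sqr; last exact: cu.1.
have h1 := energy_le_initial cV VM V0 su0 cu Hu u0E sut dut utE t0.
(* The constant 1 comes from treating the summands of [1 + t] separately: the first is paid by the
   squared initial norm, the second by the weighted norm, of which the decay estimate needs only
   half. *)
rewrite /energy in h1; rewrite mul1r mulrDl mul1r lerD//.
set W := fine _; have W0 : 0 <= W.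
  apply/fine_ge0/integral_ge0 => x Ox; rewrite lee_fin.
  by rewrite divr_ge0 ?sqr_ge0.
move: t0; rewrite le_eqVlt => /predU1P[<-|t0]; first by rewrite mul0r.
have := energy_decay cV VM V0 su0 cu Hu u0E sut dut utE oO VO u0O Wfin t0.
by rewrite -mulrA -/W /energy; lra.
Qed.
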